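(* Let $1<p<\infty$. If $A\in(l_p(r,s,t;B),bv)$, then $$\lim_{m\to\infty}\Big(\sup_{F\in\mathcal{F}_m}\Big(\sum_{k=0}^\infty\Big|\sum_{n\in F}(\tilde a_{nk}-\tilde a_{n-1,k})\Big|^{p'}\Big)^{1/p'}\Big)\le\|L_A\|_\chi\le4\lim_{m\to\infty}\Big(\sup_{F\in\mathcal{F}_m}\Big(\sum_{k=0}^\infty\Big|\sum_{n\in F}(\tilde a_{nk}-\tilde a_{n-1,k})\Big|^{p'}\Big)^{1/p'}\Big),$$ and $L_A$ is compact if and only if $$\lim_{m\to\infty}\Big(\sup_{F\in\mathcal{F}_m}\Big(\sum_{k=0}^\infty\Big|\sum_{n\in F}(\tilde a_{nk}-\tilde a_{n-1,k})\Big|^{p'}\Big)^{1/p'}\Big)=0.$$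
   Context: Sequences are indexed by $\mathbb{N}_0=\{0,1,2,\dots\}$; $\mathbb{N}=\{1,2,\dots\}$; $w$ is the space of all real or complex sequences. For $m\in\mathbb{N}$, $\mathcal{F}_m$ is the collection of nonempty finite subsets $F$ of $\mathbb{N}$ with $n>m$ for all $n\in F$. $bv=(l_1)_\Delta=\{x\in w:\Delta x\in l_1\}$ is the space of sequences of bounded variation, where $(\Delta x)_n=x_n-x_{n-1}$, $x_{-1}=0$, with norm $\|x\|_{bv}=\|\Delta x\|_{l_1}$. $r=(r_n)$, $t=(t_n)$, $s=(s_n)$ are sequences in $w$ with $r_n\ne0$, $t_n\neq 0$ for all $n$, and $s_0\neq0$; $u,v$ are nonzero scalars. $A(r,s,t)$ is the lower triangular infinite matrix with entries $s_{n-k}t_k/r_n$ for $0\le k\le n$ and $0$ for $k>n$; $B=B(u,v)=(b_{nk})$ has $b_{nn}=u$, $b_{n,n-1}=v$ and all other entries $0$. For real $p\ge1$, $l_p(r,s,t;B)=\{x\in w:(A(r,s,t)\cdot B)x\in l_p\}$ with norm $\|x\|=\|(A(r,s,t)\cdot B)x\|_{l_p}$ (a $BK$ space, i.e. a Banach sequence space with continuous coordinates). $p'=p/(p-1)$. $D^{(s)}_0=1/s_0$ and, for $n\ge1$, $D^{(s)}_n=s_0^{-(n+1)}\det(d_{ij})_{1\le i,j\le n}$ with $d_{ij}=s_{i-j+1}$ if $j\le i+1$ and $d_{ij}=0$ if $j>i+1$. For sequence spaces $U,V$, $(U,V)$ is the class of infinite matrices $A=(a_{nk})$ such that for all $x\in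 U$ the series $(Ax)_n=\sum_ka_{nk}x_k$ converge and $Ax\in V$. $L_A$ is the operator $L_A(x)=Ax$ (bounded when $U,V$ are $BK$ spaces with $U$ containing all finite sequences). For a matrix $A=(a_{nk})$, $$\tilde a_{nk}=r_k\Big[\frac{a_{nk}}{s_0t_k}\frac1u+\sum_{i=k}^{k+1}(-1)^{i-k}\frac{D^{(s)}_{i-k}}{t_i}\Big(\sum_{j=k+1}^\infty\frac{(-v)^{j-i}}{u^{j-i+1}}a_{nj}\Big)+\sum_{i=k+2}^\infty(-1)^{i-k}\frac{D^{(s)}_{i-k}}{t_i}\Big(\sum_{j=i}^\infty\frac{(-v)^{j-i}}{u^{j-i+1}}a_{nj}\Big)\Big],$$ provided the series converge. The Hausdorff measure of noncompactness of a bounded subset $Q$ of a metric space $X$ is $\chi(Q)=\inf\{\epsilon>0: Q\subset\bigcup_{i=0}^nB(x_i,r_i),\ x_i\in X,\ r_i<\epsilon,\ n\in\mathbb{N}_0\}$, where $B(x_i,r_i)$ are open balls. For a bounded operator $L:X\to Y$ between Banach spaces, $\|L\|_\chi=\chi(L(S_X))$ with $S_X$ the unit sphere of $X$.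
   Formalization: Besides convergence of the inner and outer series defining ã_{nk}, it is assumed that the double series over k+2 ≤ i ≤ j converges as a double series (rectangular partial sums have a joint limit); with iterated convergence alone the claim is false. *)

(* Defs.v *)
From HB Require Import structures.
From mathcomp Require Import all_boot all_order all_algebra finmap.
From mathcomp Require Import complex.
From mathcomp Require Import all_classical all_reals all_analysis.
Set Implicit Arguments.
Unset Strict Implicit.
Unset Printing Implicit Defensive.
Import Order.TTheory GRing.Theory Num.Theory.
Import numFieldNormedType.Exports.
Local Open Scope classical_set_scope.
Local Open Scope ring_scope.

Local Notation "\sum_ ( m <= i '<oo' ) F" :=
  (limn (fun N : nat => \sum_(m <= i < N) F)) : ring_scope.

Variant scalars := RealScalars | ComplexScalars.

Definition scalar_field (R : realType) (c : scalars) : numFieldType :=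
  match c with RealScalars => R | ComplexScalars => R[i] end.

Definition modulus (R : realType) (c : scalars) : scalar_field R c -> R :=
  match c with
  | RealScalars => fun x : R => `|x|
  | ComplexScalars => fun z : R[i] => ComplexField.Normc.normc z
  end.

(* The norm is total and [+oo] is allowed off the carrier. *)
Record normed_seq_space (R : realType) (c : scalars) := NormedSeqSpace {
  carrier :> set (nat -> scalar_field R c);
  snorm : (nat -> scalar_field R c) -> \bar R
}.

Section Definitions.
Variables (R : realType) (c : scalars).
Local Notation K := (scalar_field R c).
Implicit Types (p : R) (x r s t : nat -> K) (u v : K) (A B : nat -> nat -> K).

Definition lp_norm p x : \bar R :=
  Lnorm counting p%:E (fun k => (modulus (x k))%:E).

Definition lp p : set (nat -> K) := [set x | (lp_norm p x < +oo)%E].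

Definition Delta x : nat -> K :=
  fun n => x n - (if n is m.+1 then x m else 0).

Definition bv : normed_seq_space R c :=
  NormedSeqSpace [set x | lp 1 (Delta x)] (fun x => lp_norm 1 (Delta x)).

Definition mxapply A x : nat -> K := fun n => \sum_(0 <= k <oo) A n k * x k.

Definition mxprod A B : nat -> nat -> K :=
  fun n k => \sum_(0 <= j <oo) A n j * B j k.

Definition mean_mx r s t : nat -> nat -> K :=
  fun n k => if (k <= n)%N then s (n - k)%N * t k / r n else 0.

Definition band_mx u v : nat -> nat -> K :=
  fun n k => if k == n then u else if k.+1 == n then v else 0.

Definition lp_rst p r s t u v : normed_seq_space R c :=
  let T := mxapply (mxprod (mean_mx r s t) (band_mx u v)) in
  NormedSeqSpace [set x | lp p (T x)] (fun x => lp_norm p (T x)).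

Definition mx_class (U V : set (nat -> K)) A : Prop :=
  forall x, U x ->
    (forall n, cvgn (series (fun k => A n k * x k))) /\ V (mxapply A x).

(* Indices start at 0 here, which leaves [i - j + 1] and [j <= i + 1]
   unchanged. *)
Definition Ds s (n : nat) : K :=
  if n is 0 then (s 0%N)^-1 else
  (s 0%N) ^- n.+1 *
  \det (\matrix_(i < n, j < n)
          if (j <= i.+1)%N then s (i.+1 - j)%N else 0).

Definition tilde_weight s t (k i : nat) : K :=
  (-1) ^+ (i - k) * (Ds s (i - k) / t i).

Definition tilde_term u v A (n i j : nat) : K :=
  (- v) ^+ (j - i) / u ^+ (j - i).+1 * A n j.

Definition tilde_mx r s t u v A : nat -> nat -> K := fun n k =>
  r k * (A n k / (s 0%N * t k) * u^-1
    + \sum_(k <= i < k.+2)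
        tilde_weight s t k i * (\sum_(k.+1 <= j <oo) tilde_term u v A n i j)
    + \sum_(k.+2 <= i <oo)
        tilde_weight s t k i * (\sum_(i <= j <oo) tilde_term u v A n i j)).

(* Convergence of the series in [tilde_mx]: the inner series, the outer series,
   and the double series over [k + 2 <= i <= j] in Pringsheim's sense (its
   rectangular partial sums have a joint limit).  Existence of the iterated sum
   alone would not determine the action of [A]: even for rows [A n] in the
   beta-dual of [lp_rst], the order of summation may then matter. *)
Definition tilde_cvg s t u v A : Prop := forall n k,
  [/\ forall i, (k <= i < k.+2)%N ->
        cvgn (fun N => \sum_(k.+1 <= j < N) tilde_term u v A n i j),
      forall i, (k.+2 <= i)%N ->
        cvgn (fun N => \sum_(i <= j < N) tilde_term u v A n i j),
      cvgn (fun M => \sum_(k.+2 <= i < M)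
        tilde_weight s t k i * (\sum_(i <= j <oo) tilde_term u v A n i j))
    & cvg ((fun MN : nat * nat => \sum_(k.+2 <= i < MN.1)
        tilde_weight s t k i * (\sum_(i <= j < MN.2) tilde_term u v A n i j))
        @ filter_prod \oo \oo)].

Definition hausdorff_mnc (X : normed_seq_space R c) (Q : set (nat -> K)) :
    \bar R :=
  ereal_inf [set e%:E | e in [set e : R | 0 < e /\
    exists (n : nat) (x : nat -> nat -> K) (rad : nat -> R),
      (forall i, (i <= n)%N -> carrier X (x i) /\ 0 < rad i < e) /\
      Q `<=` \bigcup_(i in [set i | (i <= n)%N])
               [set y | carrier X y /\ (snorm X (y - x i)%R < (rad i)%:E)%E]]].

Definition sphere (X : normed_seq_space R c) : set (nat -> K) :=
  [set x | carrier X x /\ snorm X x = 1%E].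

Definition op_chi (X Y : normed_seq_space R c)
    (L : (nat -> K) -> nat -> K) : \bar R :=
  hausdorff_mnc Y (L @` sphere X).

Definition compact_op (X Y : normed_seq_space R c)
    (L : (nat -> K) -> nat -> K) : Prop :=
  (forall x, carrier X x -> carrier Y (L x)) /\
  forall z : nat -> nat -> K,
    (forall i, carrier X (z i)) ->
    (exists C : R, forall i, (snorm X (z i) <= C%:E)%E) ->
    exists phi : nat -> nat, {homo phi : m n / (m < n)%N} /\
      exists2 y, carrier Y y & snorm Y (L (z (phi i)) - y)%R @[i --> \oo] --> 0%E.

Definition Fm (m : nat) : set {fset nat} :=
  [set F | F != fset0 /\ forall n, n \in F -> (m < n)%N].

Definition tail_sup (q : R) (a : nat -> nat -> K) (m : nat) : \bar R :=
  ereal_sup [set lp_norm q (fun k => \sum_(n <- F) (a n k - a n.-1 k))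
            | F in Fm m].

End Definitions.

(* Main.v *)
Require Import Defs.
From HB Require Import structures.
From mathcomp Require Import all_boot all_order all_algebra finmap.
From mathcomp Require Import complex.
From mathcomp Require Import all_classical all_reals all_analysis.
From mathcomp Require Import ring lra.
Import Order.TTheory GRing.Theory Num.Theory.
Import numFieldNormedType.Exports.
Local Open Scope classical_set_scope.
Local Open Scope ring_scope.
Set Implicit Arguments.
Unset Strict Implicit.
Unset Printing Implicit Defensive.

(** The mean matrix followed by the band matrix is a lower triangular matrix T
    with nonzero diagonal, so T is a bijection of the space of all sequences
    and an isometry of [lp_rst] onto l_p.  Under it the operator A becomes
    A T^-1, and the first point is that this operator is given on l_p by the
    matrix [tilde_mx].  Both factors of T are convolutions up to diagonal
    scalings, so T^-1 is explicit: it convolves with the inverse of s, whose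
    n-th term is (-1)^n D_n by Cramer's rule ([conv_inverse_det]), and with
    the geometric sequence (-v)^m / u^(m+1).  Multiplying row n of A, cut off
    at N, by T^-1 gives a finitely supported row that converges entrywise to
    row n of [tilde_mx] ([tilde_partial_cvg]).  Entrywise convergence says
    little about the action on l_p; a gliding hump argument
    ([gliding_hump], a uniform boundedness principle) bounds the truncated rows
    in l_p', and then the action converges too ([row_representation]).

    It remains to treat a matrix a that maps l_p into bv.  Let G_n denote the
    difference of rows n and n - 1.  The map [Delta] is an isometry of bv onto
    l_1, where noncompactness is measured by the tails of the sum of |G_n y|
    over n > m, uniformly for y in the unit sphere.  Such tails are comparable to
    [tail_sup]: by l_p-l_p' duality [tail_sup] at m is the supremum, over y in
    the sphere and finite sets F beyond m, of |sum over F of G_n y|.  This is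
    at most the tail, and since a finite family of scalars z_n satisfies
    sum |z_n| <= 4 max_F |sum over F of z_n| ([sum_modulus_le4]), the tail is
    at most 4 times [tail_sup] ([tail_sup_le], [tail_Delta_le]).

    A finite cover of the image by balls of radius less than e forces
    [tail_sup] to be at most e in the limit, because the finitely many centres
    have small tails ([tail_sup_lim_le_chi]).  Conversely the first m + 1
    differences stay in a bounded box, which has a finite net, so the image is
    covered by balls whose radius exceeds the tail as little as desired
    ([chi_le_tail_sup_lim]).  When the limit vanishes, coordinatewise limits
    along an ultrafilter become norm limits because the tails are uniformly
    small ([compact_of_tail_sup]).  When it does not, the vectors that witness
    large tails further and further out have images without a convergent
    subsequence ([tail_sup_of_compact]). *)

(** * Real and complex scalars *)

Section Scalars.
Variables (R : realType) (c : scalars).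
Local Notation K := (scalar_field R c).
Implicit Types (x y z : K).

Definition of_real : R -> K :=
  match c as c0 return R -> scalar_field R c0 with
  | RealScalars => fun a => a | ComplexScalars => fun a => (a%:C)%C end.
(** For real scalars the conventions are Im x = 0 and a + ib := a, so that the
    estimates through real and imaginary parts hold for both kinds of
    scalars. *)
Definition re_part : K -> R :=
  match c as c0 return scalar_field R c0 -> R with
  | RealScalars => fun a => a | ComplexScalars => fun w => complex.Re w end.
Definition im_part : K -> R :=
  match c as c0 return scalar_field R c0 -> R with
  | RealScalars => fun=> 0 | ComplexScalars => fun w => complex.Im w end.
Definition of_parts : R -> R -> K :=
  match c as c0 return R -> R -> scalar_field R c0 with
  | RealScalars => fun a _ => a | ComplexScalars => fun a b => (a +i* b)%C end.

Lemma of_realD a b : of_real (a + b) = of_real a + of_real b.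
Proof. by rewrite /of_real; case: c => //; exact: rmorphD. Qed.
Lemma of_realM a b : of_real (a * b) = of_real a * of_real b.
Proof. by rewrite /of_real; case: c => //; exact: rmorphM. Qed.
Lemma of_real0 : of_real 0 = 0.
Proof. by rewrite /of_real; case: c. Qed.
Lemma of_real_le a b : (of_real a <= of_real b) = (a <= b).
Proof. by rewrite /of_real; case: c => //; exact: lecR. Qed.
Lemma of_real_lt a b : (of_real a < of_real b) = (a < b).
Proof. by rewrite /of_real; case: c => //; exact: ltcR. Qed.
Lemma of_real_modulus x : of_real (modulus x) = `|x|.
Proof. by move: x; rewrite /of_real /modulus; case: c => //= -[]. Qed.
Lemma of_real_sum (I : Type) (s : seq I) (P : pred I) (F : I -> R) :
  of_real (\sum_(i <- s | P i) F i) = \sum_(i <- s | P i) of_real (F i).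
Proof. exact: (big_morph of_real of_realD of_real0). Qed.
Lemma of_real_inj : injective of_real.
Proof. by move=> a b ab; apply/eqP; rewrite eq_le -!of_real_le ab lexx. Qed.
Lemma of_real_pos_ex (e : K) : 0 < e -> exists2 a : R, 0 < a & of_real a = e.
Proof.
move=> e0; exists (modulus e).
  by rewrite -of_real_lt of_real_modulus of_real0 normr_gt0 gt_eqF.
by rewrite of_real_modulus gtr0_norm.
Qed.

Lemma modulus_ge0 x : 0 <= modulus x.
Proof. by rewrite -of_real_le of_real_modulus of_real0 normr_ge0. Qed.
Lemma modulus0 : modulus (0 : K) = 0.
Proof. by apply: of_real_inj; rewrite of_real_modulus of_real0 normr0. Qed.
Lemma modulus_eq0 x : modulus x = 0 -> x = 0.
Proof.
by move=> h; apply/normr0_eq0; rewrite -of_real_modulus h of_real0.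
Qed.
Lemma modulusM x y : modulus (x * y) = modulus x * modulus y.
Proof.
by apply: of_real_inj; rewrite of_realM !of_real_modulus normrM.
Qed.
Lemma modulusN x : modulus (- x) = modulus x.
Proof. by apply: of_real_inj; rewrite !of_real_modulus normrN. Qed.
Lemma modulusD x y : modulus (x + y) <= modulus x + modulus y.
Proof. by rewrite -of_real_le of_realD !of_real_modulus ler_normD. Qed.
Lemma modulusB x y : modulus (x - y) <= modulus x + modulus y.
Proof. by rewrite (le_trans (modulusD _ _))// modulusN. Qed.
Lemma modulus_distrC x y : modulus (x - y) = modulus (y - x).
Proof. by rewrite -modulusN opprB. Qed.
Lemma modulus_of_real a : modulus (of_real a) = `|a|.
Proof.
rewrite /modulus /of_real; case: c => //=.
by rewrite expr0n /= addr0 sqrtr_sqr.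
Qed.
Lemma modulus_sum (I : Type) (s : seq I) (P : pred I) (F : I -> K) :
  modulus (\sum_(i <- s | P i) F i) <= \sum_(i <- s | P i) modulus (F i).
Proof.
elim/big_ind2 : _ => [|a b a' b' h h'|//]; first by rewrite modulus0.
exact: le_trans (modulusD _ _) (lerD h h').
Qed.
Lemma modulus_le_of_dist x y : modulus x <= modulus y + modulus (x - y).
Proof. by rewrite -{1}(subrK y x) addrC; exact: modulusD. Qed.

Lemma re_partD x y : re_part (x + y) = re_part x + re_part y.
Proof. by move: x y; rewrite /re_part; case: c => //= -[? ?] []. Qed.
Lemma im_partD x y : im_part (x + y) = im_part x + im_part y.
Proof.
by move: x y; rewrite /im_part; case: c => /= [_ _|[? ?] []//]; rewrite addr0.
Qed.
Lemma re_part0 : re_part 0 = 0.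
Proof. by rewrite /re_part; case: c. Qed.
Lemma im_part0 : im_part 0 = 0.
Proof. by rewrite /im_part; case: c. Qed.
Lemma re_part_sum (I : Type) (s : seq I) (P : pred I) (F : I -> K) :
  re_part (\sum_(i <- s | P i) F i) = \sum_(i <- s | P i) re_part (F i).
Proof. exact: (big_morph re_part re_partD re_part0). Qed.
Lemma im_part_sum (I : Type) (s : seq I) (P : pred I) (F : I -> K) :
  im_part (\sum_(i <- s | P i) F i) = \sum_(i <- s | P i) im_part (F i).
Proof. exact: (big_morph im_part im_partD im_part0). Qed.
Lemma re_part_le x : `|re_part x| <= modulus x.
Proof.
move: x; rewrite /re_part /modulus; case: c => //= -[a b] /=.
by rewrite -sqrtr_sqr ler_wsqrtr// lerDl sqr_ge0.
Qed.
Lemma im_part_le x : `|im_part x| <= modulus x.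
Proof.
move: x; rewrite /im_part /modulus; case: c => /= [x|[a b] /=].
  by rewrite normr0.
by rewrite -sqrtr_sqr ler_wsqrtr// lerDr sqr_ge0.
Qed.
Lemma modulus_sub_of_parts x a b :
  modulus (x - of_parts a b) <= `|re_part x - a| + `|im_part x - b|.
Proof.
move: x; rewrite /re_part /im_part /modulus /of_parts; case: c => /= [x|[a' b']/=].
  by rewrite lerDl.
set u := a' - a; set w := b' - b.
rewrite -(@ler_pXn2r _ 2)// ?nnegrE ?sqrtr_ge0 ?addr_ge0// sqr_sqrtr ?addr_ge0 ?sqr_ge0//.
rewrite [leRHS]sqrrD !real_normK ?num_real// addrAC lerDl.
by rewrite mulrn_wge0// mulr_ge0.
Qed.
Lemma modulus_le_parts x : modulus x <= `|re_part x| + `|im_part x|.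
Proof.
have := modulus_sub_of_parts x 0 0; rewrite !subr0.
suff -> : of_parts 0 0 = 0 by rewrite subr0.
by rewrite /of_parts; case: c.
Qed.

(** The multiplier with which Hoelder's inequality becomes an equality. *)
Lemma phase_ex x : exists w : K, modulus w = 1 /\ w * x = of_real (modulus x).
Proof.
rewrite of_real_modulus; have [->|x0] := eqVneq x 0.
  by exists 1; rewrite mulr0 normr0; split=> //; apply: of_real_inj;
     rewrite of_real_modulus normr1 /of_real; case: c.
exists (`|x| / x); split; last by rewrite mulfVK.
apply: of_real_inj; rewrite of_real_modulus normrM normr_id normfV mulfV ?normr_eq0//.
by rewrite /of_real; case: c.
Qed.

(** Convergence in K is tested with positive elements of K, which are the images
    of the positive reals; this lets all later estimates take place in R. *)
Lemma cvg_modulusP (u : nat -> K) (l : K) :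
  u @ \oo --> l <->
  (forall e : R, 0 < e -> exists N, forall n, (N <= n)%N -> modulus (u n - l) <= e).
Proof.
split=> [ul e e0|h].
  have /cvgrPdist_le/(_ (of_real e)) := ul.
  rewrite -of_real0 of_real_lt => /(_ e0)[N _ hN]; exists N => n Nn.
  by have := hN n Nn; rewrite /= -of_real_modulus of_real_le modulus_distrC.
apply/cvgrPdist_le => e /of_real_pos_ex[a a0 <-].
have [N hN] := h a a0; exists N => // n /hN.
by rewrite /= -of_real_modulus of_real_le modulus_distrC.
Qed.

Lemma modulus_lim_le (u : nat -> K) (l : K) (B : R) : u @ \oo --> l ->
  (exists N, forall n, (N <= n)%N -> modulus (u n) <= B) -> modulus l <= B.
Proof.
move=> /cvg_modulusP ul [N hN]; apply/ler_addgt0Pr => e e0.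
have [N' hN'] := ul e e0; pose n := maxn N N'.
rewrite (le_trans (modulus_le_of_dist l (u n)))// lerD//.
  by apply: hN; exact: leq_maxl.
by rewrite modulus_distrC hN'// leq_maxr.
Qed.

Lemma cvg_bounded (u : nat -> K) (l : K) : u @ \oo --> l ->
  exists2 B : R, 0 <= B & forall n, modulus (u n) <= B.
Proof.
move=> /cvg_modulusP/(_ 1 ltr01)[N hN].
exists (modulus l + 1 + \sum_(0 <= i < N) modulus (u i)).
  by rewrite !addr_ge0 ?modulus_ge0// sumr_ge0// => i _; exact: modulus_ge0.
move=> n; have [Nn|nN] := leqP N n.
  rewrite (le_trans (modulus_le_of_dist (u n) l))// -addrA lerD2l.
  by rewrite (le_trans (hN _ Nn))// lerDl sumr_ge0// => i _; exact: modulus_ge0.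
rewrite (bigD1_seq n)/= ?mem_index_iota ?iota_uniq// addrCA lerDl.
by rewrite !addr_ge0 ?modulus_ge0 ?sumr_ge0// => i _; exact: modulus_ge0.
Qed.

Lemma cvg_ev_cst (u : nat -> K) (l : K) (N : nat) :
  (forall n, (N <= n)%N -> u n = l) -> u @ \oo --> l.
Proof.
move=> h; apply/cvg_modulusP => e e0; exists N => n /h ->.
by rewrite subrr modulus0 ltW.
Qed.

Lemma cvg_scalar_unique (u : nat -> K) (l l' : K) :
  u @ \oo --> l -> u @ \oo --> l' -> l = l'.
Proof. exact: cvg_unique. Qed.

Lemma cvg_sum_seq (s : seq nat) (P : pred nat) (u : nat -> nat -> K) (l : nat -> K) :
  (forall k, P k -> (fun N => u N k) @ \oo --> l k) ->
  (fun N => \sum_(k <- s | P k) u N k) @ \oo --> \sum_(k <- s | P k) l k.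
Proof.
move=> ul; elim: s => [|k s IH].
  by rewrite big_nil; apply: (@cvg_ev_cst _ _ 0) => N _; rewrite big_nil.
rewrite big_cons; under eq_fun do rewrite big_cons.
by case: ifP => // Pk; apply: cvgD => //; exact: ul.
Qed.

Lemma cvg_lincomb (s : seq nat) (u : nat -> nat -> K) (l a : nat -> K) :
  (forall k, (fun N => u N k) @ \oo --> l k) ->
  (fun N => \sum_(k <- s) u N k * a k) @ \oo --> \sum_(k <- s) l k * a k.
Proof.
move=> ul; apply: (cvg_sum_seq _ (u := fun N k => u N k * a k)) => k _.
by apply: cvgM => //; exact: cvg_cst.
Qed.

End Scalars.

(** * The l_p norm through its finite partial sums *)

Section LpNorm.
Variables (R : realType) (c : scalars).
Local Notation K := (scalar_field R c).
Implicit Types (x y z : nat -> K) (p : R).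

Lemma lp_norm_ge0 p x : (0 <= lp_norm p x)%E.
Proof. exact: Lnorm_ge0. Qed.

(** This is the bridge to finite sums: a norm bound is a bound on every
    partial sum, so no extended real has to be manipulated afterwards. *)
Lemma lp_norm_leP p x (C : R) : 0 < p -> 0 <= C ->
  (lp_norm p x <= C%:E)%E <->
  forall N, \sum_(0 <= k < N) modulus (x k) `^ p <= C `^ p.
Proof.
move=> p0 C0; rewrite /lp_norm Lnorm_counting//.
set u := (fun k : nat => (`|(modulus (x k))%:E| `^ p)%E).
have uE k : u k = (modulus (x k) `^ p)%:E.
  by rewrite /u/= ger0_norm// modulus_ge0.
have u0 k : (0 <= u k)%E by rewrite uE lee_fin powR_ge0.
have sE N : (\sum_(0 <= k < N) u k)%E =
            (\sum_(0 <= k < N) modulus (x k) `^ p)%:E.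
  by rewrite -sumEFin; apply: eq_bigr => k _; exact: uE.
have S0 : (0 <= \sum_(k <oo) u k)%E by apply: nneseries_ge0 => k _ _; exact: u0.
have pn0 : p != 0 by rewrite gt_eqF.
split=> [h N|h].
  rewrite -lee_fin -sE; apply: le_trans (nneseries_lim_ge N _) _ => //.
  have := h => /(@gt0_ler_poweR _ p (ltW p0)).
  rewrite -poweRrM mulVf// poweRe1// poweR_EFin; apply.
    by rewrite in_itv/= poweR_ge0 leey.
  by rewrite in_itv/= lee_fin C0 leey.
have : (\sum_(k <oo) u k <= (C `^ p)%:E)%E.
  apply: lime_le; first by apply: is_cvg_nneseries => k _ _; exact: u0.
  by apply: nearW => N; rewrite sE lee_fin; exact: h.
have pV0 : 0 <= p^-1 by rewrite invr_ge0 ltW.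
move=> /(@gt0_ler_poweR _ p^-1 pV0).
rewrite poweR_EFin -powRrM mulfV// powRr1//; apply.
  by rewrite in_itv/= S0 leey.
by rewrite in_itv/= lee_fin powR_ge0 leey.
Qed.

Lemma lp_norm1_leP x (C : R) : 0 <= C ->
  (lp_norm 1 x <= C%:E)%E <-> forall N, \sum_(0 <= k < N) modulus (x k) <= C.
Proof.
move=> C0; rewrite lp_norm_leP// powRr1//.
suff E N : \sum_(0 <= k < N) modulus (x k) `^ 1 = \sum_(0 <= k < N) modulus (x k).
  by split=> h N; have := h N; rewrite E.
by apply: eq_bigr => k _; rewrite powRr1// modulus_ge0.
Qed.

Lemma lp_norm_ltP p x (C : R) : (lp_norm p x < C%:E)%E ->
  exists D : R, [/\ 0 <= D, D < C & (lp_norm p x <= D%:E)%E].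
Proof.
have := lp_norm_ge0 p x; case: (lp_norm p x) => [D| |]//; rewrite lee_fin lte_fin.
by move=> D0 DC; exists D.
Qed.

Lemma lpP p x : lp p x <-> exists C : R, 0 <= C /\ (lp_norm p x <= C%:E)%E.
Proof.
rewrite /lp/=; split=> [|[C [C0 h]]]; last exact: le_lt_trans h (ltry _).
have := lp_norm_ge0 p x; case: (lp_norm p x) => [D| |]//; rewrite lee_fin.
by move=> D0 _; exists D.
Qed.

Lemma lp_norm_fin_supp p x N : 0 < p ->
  (forall k, (N <= k)%N -> x k = 0) ->
  \sum_(0 <= k < N) modulus (x k) `^ p = 1 -> lp_norm p x = 1%E.
Proof.
move=> p0 x0 S1.
have p1 : (1 : R) `^ p = 1 by rewrite powR1.
apply/eqP; rewrite eq_le; apply/andP; split.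
  apply/lp_norm_leP => // M; rewrite p1 -S1.
  have [MN|NM] := leqP M N.
    rewrite (@big_cat_nat _ _ _ M 0 N)//= lerDl sumr_ge0// => k _; exact: powR_ge0.
  rewrite (@big_cat_nat _ _ _ N 0 M) ?(ltnW NM)//= gerDl big_nat_cond big1// => k.
  by rewrite andbT => /andP[/x0 -> _]; rewrite modulus0 powR0// gt_eqF.
rewrite leNgt; apply/negP => /lp_norm_ltP[D [D0 D1 /lp_norm_leP]].
move=> /(_ p0 D0 N); rewrite S1 leNgt => /negP; apply.
by rewrite -p1; apply: gt0_ltr_powR; rewrite ?nnegrE.
Qed.

(** The degenerate case of the Hoelder inequality, in which one factor vanishes
    and the other cannot be normalized. *)
Lemma pairing_powR_eq0 (I : Type) (s : seq I) (f h : I -> K) (r : R) : 0 < r ->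
  \sum_(k <- s) modulus (f k) `^ r <= 0 `^ r -> \sum_(k <- s) f k * h k = 0.
Proof.
move=> r0; rewrite powR0 ?gt_eqF//; elim: s => [|k s IH]; first by rewrite !big_nil.
have s0 : 0 <= \sum_(j <- s) modulus (f j) `^ r.
  by rewrite sumr_ge0// => i _; exact: powR_ge0.
rewrite !big_cons => h0.
rewrite IH; last by apply: le_trans h0; rewrite lerDr powR_ge0.
suff -> : f k = 0 by rewrite mul0r addr0.
apply/modulus_eq0/(@powR_eq0_eq0 _ _ r)/eqP.
by rewrite eq_le powR_ge0 andbT (le_trans _ h0)// lerDl.
Qed.

Section Conj.
Variables (p : R) (hp : 1 < p).
Local Notation q := (p / (p - 1)).

Let p0 : 0 < p. Proof. exact: lt_trans ltr01 hp. Qed.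
Let pB0 : 0 < p - 1. Proof. by rewrite subr_gt0. Qed.
Lemma conj_exp_gt0 : 0 < q. Proof. by rewrite divr_gt0. Qed.
Lemma conj_expV : p^-1 + q^-1 = 1.
Proof.
rewrite invf_div mulrBl mul1r mulfV ?gt_eqF//.
by rewrite addrC subrK.
Qed.
Lemma conj_expM : (q - 1) * p = q.
Proof. by field; rewrite gt_eqF. Qed.

(** Young's inequality, applied to the families divided by their norm bounds and
    summed. *)
Lemma finite_hoelder (I : Type) (s : seq I) (g y : I -> K) (C D : R) :
  0 <= C -> 0 <= D ->
  \sum_(k <- s) modulus (g k) `^ q <= D `^ q ->
  \sum_(k <- s) modulus (y k) `^ p <= C `^ p ->
  modulus (\sum_(k <- s) g k * y k) <= D * C.
Proof.
have q0 := conj_exp_gt0.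
rewrite [0 <= C]le_eqVlt [0 <= D]le_eqVlt.
move=> /predU1P[<- _ _ hy|C0].
  by under eq_bigr do rewrite mulrC; rewrite (pairing_powR_eq0 _ p0 hy) modulus0 mulr0.
move=> /predU1P[<- hg _|D0 hg hy].
  by rewrite (pairing_powR_eq0 _ q0 hg) modulus0 mul0r.
apply: le_trans (modulus_sum _ _ _) _.
have key k : modulus (g k * y k) <=
    D * C * ((modulus (g k) `^ q / D `^ q) / q + (modulus (y k) `^ p / C `^ p) / p).
  rewrite modulusM.
  have -> : modulus (g k) * modulus (y k) =
      D * C * ((modulus (g k) / D) * (modulus (y k) / C)).
    by field; rewrite !gt_eqF.
  rewrite ler_pM2l ?mulr_gt0//.
  have V (a : R) (r : R) (m : R) : 0 < a -> 0 <= m -> (m / a) `^ r = m `^ r / a `^ r.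
    move=> a0 m0; rewrite powRM ?invr_ge0 ?(ltW a0)//.
    by rewrite -(powR_inv1 (ltW a0)) -powRrM mulN1r powRN.
  rewrite -!V ?modulus_ge0//; apply: conjugate_powR => //.
  - by rewrite divr_ge0 ?modulus_ge0 ?ltW.
  - by rewrite divr_ge0 ?modulus_ge0 ?ltW.
  - by rewrite addrC conj_expV.
apply: le_trans (ler_sum _ (fun k _ => key k)) _.
rewrite -mulr_sumr ler_piMr ?(ltW (mulr_gt0 D0 C0))// big_split/= -!mulr_suml.
apply: (@le_trans _ _ (q^-1 + p^-1)); last by rewrite addrC conj_expV.
apply: lerD.
  by rewrite ler_piMl ?invr_ge0 ?(ltW q0)// ler_pdivrMr ?powR_gt0// mul1r.
by rewrite ler_piMl ?invr_ge0 ?(ltW p0)// ler_pdivrMr ?powR_gt0// mul1r.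
Qed.

(** Equality in Hoelder's inequality: up to normalization the extremal vector is
    the phase of g times |g|^(q-1), whose p-th powers are |g|^q since
    (q-1)p = q. *)
Lemma dual_vector (g : nat -> K) a b :
  0 < \sum_(a <= k < b) modulus (g k) `^ q ->
  exists h : nat -> K,
    [/\ forall k, ~~ (a <= k < b)%N -> h k = 0,
        \sum_(a <= k < b) modulus (h k) `^ p = 1 &
        \sum_(a <= k < b) g k * h k =
          of_real c ((\sum_(a <= k < b) modulus (g k) `^ q) `^ q^-1)].
Proof.
set S := \sum_(a <= k < b) _ => S0; have q0 := conj_exp_gt0.
have /choice[w hw] : forall k, exists w : K, modulus w = 1 /\ w * g k = of_real c (modulus (g k)).
  by move=> k; exact: phase_ex.
pose h k : K := if (a <= k < b)%N then
  w k * of_real c (modulus (g k) `^ (q - 1) / S `^ p^-1) else 0.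
have hE k : (a <= k < b)%N -> h k =
    w k * of_real c (modulus (g k) `^ (q - 1) / S `^ p^-1).
  by rewrite /h => ->.
exists h; split.
- by move=> k /negbTE kab; rewrite /h kab.
- rewrite (eq_big_nat _ _ (F2 := fun k => modulus (g k) `^ q / S)).
    by rewrite -mulr_suml mulfV// gt_eqF.
  move=> k /hE ->; rewrite modulusM (hw k).1 mul1r modulus_of_real.
  rewrite ger0_norm ?divr_ge0 ?powR_ge0//.
  rewrite powRM ?invr_ge0 ?powR_ge0// -powRrM conj_expM; congr (_ * _).
  rewrite -powRN -powRrM mulNr mulVf ?gt_eqF//.
  by rewrite powR_inv1// ltW.
- rewrite (eq_big_nat _ _ (F2 := fun k => of_real c (modulus (g k) `^ q / S `^ p^-1))).
    rewrite -of_real_sum -mulr_suml; congr (of_real c _).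
    rewrite -/S; have -> : q^-1 = 1 - p^-1 by apply/eqP; rewrite eq_sym subr_eq addrC conj_expV.
    by rewrite powRB ?powRr1 ?(ltW S0)// (gt_eqF S0) implybT.
  move=> k /hE ->; rewrite mulrCA mulrA (hw k).2 -of_realM mulrA.
  by rewrite mulr_powRB1// modulus_ge0.
Qed.

End Conj.
End LpNorm.

(** * A uniform boundedness principle for rows on l_p *)

Lemma bounded_sums_tail (R : realType) (u : nat -> R) (B : R) :
  (forall k, 0 <= u k) -> (forall N, \sum_(0 <= k < N) u k <= B) ->
  forall e, 0 < e -> exists m, forall m' N, (m <= m')%N ->
    \sum_(m' <= k < N) u k <= e.
Proof.
move=> u0 uB e e0.
have hs : has_sup (range (fun N => \sum_(0 <= k < N) u k)).
  by split; [exists (\sum_(0 <= k < 0) u k), 0%N | exists B => _ [N _ <-]].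
have [_ [m _ <-] hm] := sup_adherent e0 hs.
exists m => m' N mm'; have [Nm|mN] := leqP N m'; first by rewrite big_geq// ltW.
have := ub_le_sup hs.2 (imageT (fun N => \sum_(0 <= k < N) u k) N).
rewrite /= (@big_cat_nat _ _ _ m' 0 N)//= ?(ltnW mN)//.
rewrite (@big_cat_nat _ _ _ m 0 m')//= => h.
have h2 : 0 <= \sum_(m <= i < m') u i by rewrite sumr_ge0.
by move: hm h h2; set s := sup _; lra.
Qed.

Section Hump.
Variables (R : realType) (c : scalars).
Local Notation K := (scalar_field R c).
Variables (p : R) (hp : 1 < p).
Local Notation q := (p / (p - 1)).
Let p0 : 0 < p. Proof. exact: lt_trans ltr01 hp. Qed.
Let q0 : 0 < q. Proof. exact: conj_exp_gt0. Qed.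

Lemma powR_invK (r a : R) : 0 < r -> 0 <= a -> (a `^ r^-1) `^ r = a.
Proof. by move=> r0 a0; rewrite -powRrM mulVf ?gt_eqF// powRr1. Qed.
Lemma powRK_inv (r a : R) : 0 < r -> 0 <= a -> (a `^ r) `^ r^-1 = a.
Proof. by move=> r0 a0; rewrite -powRrM mulfV ?gt_eqF// powRr1. Qed.

(** Only finitely many columns are involved, and each is a convergent sequence. *)
Lemma columns_bounded (g : nat -> nat -> K) (gl : nat -> K) :
  (forall k, (fun N => g N k) @ \oo --> gl k) ->
  forall n, exists2 B : R, 0 <= B &
    forall N, \sum_(0 <= k < n) modulus (g N k) `^ q <= B `^ q.
Proof.
move=> ggl n; have /choice[b hb] : forall k, exists b : R, forall N, modulus (g N k) <= b.
  by move=> k; have [b _ hb] := cvg_bounded (ggl k); exists b.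
exists ((\sum_(0 <= k < n) b k `^ q) `^ q^-1); first exact: powR_ge0.
move=> N; rewrite powR_invK//; last by rewrite sumr_ge0// => k _; exact: powR_ge0.
apply: ler_sum => k _; apply: ge0_ler_powR => //; rewrite ?nnegrE ?modulus_ge0 ?(ltW q0)//.
exact: le_trans (modulus_ge0 _) (hb k 0%N).
Qed.

(** If the norms of the truncated rows were unbounded, rows of index
    n_1 < n_2 < ... could be chosen so that the mass of row n_(j+1) on the block
    [n_j, n_(j+1)[ beats everything seen on the first n_j columns.  The vector
    that on this block is 2^-(j+1) times the extremal vector of row n_(j+1)
    lies in l_p, yet its pairings with the chosen rows are unbounded. *)
Lemma gliding_hump (g : nat -> nat -> K) (gl : nat -> K) :
  (forall k, (fun N => g N k) @ \oo --> gl k) ->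
  (forall y, lp p y -> exists B : R,
     forall N, modulus (\sum_(0 <= k < N) g N k * y k) <= B) ->
  exists2 M : R, 0 <= M &
    forall N, \sum_(0 <= k < N) modulus (g N k) `^ q <= M `^ q.
Proof.
move=> ggl hB; apply: contrapT => unb.
have unb' (M : R) : 0 <= M ->
    exists N, M < \sum_(0 <= k < N) modulus (g N k) `^ q.
  move=> M0; apply: contrapT => nN; apply: unb; exists (M `^ q^-1); first exact: powR_ge0.
  move=> N; rewrite powR_invK// leNgt; apply/negP => MN; apply: nN.
  by exists N.
have /choice[B /all_and2[B0 hBk]] n : exists B : R, 0 <= B /\
    forall N, \sum_(0 <= k < n) modulus (g N k) `^ q <= B `^ q.
  by have [b b0 hb] := columns_bounded ggl n; exists b.
(* B bounds the rows on the first n columns; the factor 2 ^ (j+1) will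
   compensate the weight 2 ^ -(j+1) of the j-th hump. *)
have step (nj : nat * nat) : exists Nh : nat * (nat -> K),
    [/\ (nj.1 < Nh.1)%N,
        forall k, ~~ (nj.1 <= k < Nh.1)%N -> Nh.2 k = 0,
        \sum_(nj.1 <= k < Nh.1) modulus (Nh.2 k) `^ p = 1 &
        exists2 s : R, 2 ^+ nj.2.+1 * (B nj.1 + nj.2%:R) <= s &
        \sum_(nj.1 <= k < Nh.1) g Nh.1 k * Nh.2 k = of_real c s].
  case: nj => n j /=; set m := 2 ^+ j.+1 * (B n + j%:R).
  have m0 : 0 <= m by rewrite mulr_ge0 ?exprn_ge0 ?addr_ge0.
  have [N hN] := unb' (B n `^ q + m `^ q) (addr_ge0 (powR_ge0 _ _) (powR_ge0 _ _)).
  have nN : (n < N)%N.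
    rewrite ltnNge; apply/negP => Nn; have := hBk n N.
    rewrite (@big_cat_nat _ _ _ N 0 n)//= => h.
    have h1 : 0 <= \sum_(N <= k < n) modulus (g N k) `^ q.
      by rewrite sumr_ge0// => k _; exact: powR_ge0.
    have := powR_ge0 m q; move: hN h h1; set a := B n `^ q; set b := m `^ q.
    by lra.
  have hS : m `^ q < \sum_(n <= k < N) modulus (g N k) `^ q.
    have := hBk n N; move: hN; rewrite (@big_cat_nat _ _ _ n 0 N) ?(ltnW nN)//=.
    by set a := B n `^ q; set b := m `^ q; lra.
  have S0 := le_lt_trans (powR_ge0 m q) hS.
  have [h [h0 h1 h2]] := dual_vector hp S0.
  exists (N, h); split => //=; eexists; last exact: h2.
  rewrite -[leLHS](powRK_inv q0 m0); apply: ge0_ler_powR; rewrite ?nnegrE ?powR_ge0//.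
  - by rewrite invr_ge0 ltW.
  - exact: ltW.
  - exact: ltW.
have {step}/choice[next hnext] := step.
pose nn := fix nn j := if j is i.+1 then (next (nn i, i)).1 else 0%N.
pose h j := (next (nn j, j)).2.
have nnS j : nn j.+1 = (next (nn j, j)).1 by [].
have nn_lt j : (nn j < nn j.+1)%N by rewrite nnS; have [] := hnext (nn j, j).
have nn_homo : {homo nn : i j / (i <= j)%N >-> (i <= j)%N}.
  by apply: homo_leq => [//|j i k|i]; [exact: leq_trans | exact: ltnW].
have nn_ge j : (j <= nn j)%N by elim: j => // j IH; exact: leq_ltn_trans (nn_lt j).
have h0 j k : ~~ (nn j <= k < nn j.+1)%N -> h j k = 0.
  by rewrite nnS => /(let: And4 _ a _ _ := hnext (nn j, j) in a).
(* At most one term is nonzero: the humps have disjoint supports. *)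
pose y k := \sum_(0 <= j < k.+1) of_real c (2^-1 ^+ j.+1) * h j k.
have yE j k : (nn j <= k < nn j.+1)%N -> y k = of_real c (2^-1 ^+ j.+1) * h j k.
  move=> /andP[jk kj]; rewrite /y (bigD1_seq j) ?mem_index_iota ?iota_uniq//=; last first.
    by rewrite ltnS (leq_trans (nn_ge j)).
  rewrite big1 ?addr0// => i ij; rewrite h0 ?mulr0//.
  move: ij; rewrite neq_ltn => /orP[ij|ji]; rewrite negb_and -leqNgt -ltnNge.
    by rewrite (leq_trans _ jk) ?orbT// nn_homo.
  by rewrite (leq_trans kj)// nn_homo.
have half_gt0 j : (0 : R) < 2^-1 ^+ j by rewrite exprn_gt0// invr_gt0.
have half_le1 j : (2^-1 : R) ^+ j <= 1.
  by rewrite exprn_ile1// ?invr_ge0// invf_le1// ler1n.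
(* The p-th powers of the weights are dominated by the weights, because they
   are at most 1. *)
have ynorm j : \sum_(0 <= k < nn j) modulus (y k) `^ p <= 1 - 2^-1 ^+ j.
  elim: j => [|j IH]; first by rewrite big_geq// expr0 subrr.
  rewrite (@big_cat_nat _ _ _ (nn j)) ?(ltnW (nn_lt j))//=.
  have -> : \sum_(nn j <= k < nn j.+1) modulus (y k) `^ p = (2^-1 ^+ j.+1) `^ p.
    have [_ _ h1 _] := hnext (nn j, j).
    rewrite (eq_big_nat _ _ (F2 := fun k => (2^-1 ^+ j.+1) `^ p * modulus (h j k) `^ p)).
      by rewrite -mulr_sumr h1 mulr1.
    move=> k /yE ->; rewrite modulusM modulus_of_real ger0_norm ?(ltW (half_gt0 _))//.
    by rewrite powRM// ?modulus_ge0// ltW.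
  have : (2^-1 ^+ j.+1) `^ p <= 2^-1 ^+ j.+1 :> R.
    by apply: ge1r_powR; rewrite ?half_gt0 ?half_le1// ltW.
  move: IH; rewrite exprS; set a := _ `^ p; set b := 2^-1 ^+ j.
  by set S := \sum_(_ <= _ < _) _; lra.
have y1 N : \sum_(0 <= k < N) modulus (y k) `^ p <= 1 `^ p.
  rewrite powR1; apply: le_trans (_ : _ <= \sum_(0 <= k < nn N) modulus (y k) `^ p) _.
    rewrite (@big_cat_nat _ _ _ N 0 (nn N))//= lerDl sumr_ge0// => k _; exact: powR_ge0.
  by rewrite (le_trans (ynorm N))// gerDl oppr_le0 ltW.
have ylp : lp p y by apply/lpP; exists 1; split => //; apply/lp_norm_leP.
have [b hb] := hB y ylp.
have hj j : j%:R <= b.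
  have [_ _ _ [s hs h2]] := hnext (nn j, j).
  have := hb (nn j.+1); rewrite (@big_cat_nat _ _ _ (nn j)) ?(ltnW (nn_lt j))//=.
  have -> : \sum_(nn j <= k < nn j.+1) g (nn j.+1) k * y k = of_real c (2^-1 ^+ j.+1 * s).
    rewrite of_realM -h2 mulr_sumr; apply: eq_big_nat => k kj; rewrite (yE j)//.
    by rewrite mulrCA.
  have hd := finite_hoelder hp ler01 (B0 (nn j)) (hBk (nn j) (nn j.+1)) (y1 (nn j)).
  rewrite mulr1 in hd; set u := \sum_(0 <= i < nn j) _ in hd *.
  set w := of_real c _ => hle.
  have wE : B (nn j) + j%:R <= modulus w.
    rewrite modulus_of_real (le_trans _ (ler_norm _))//.
    rewrite -(ler_pM2l (exprn_gt0 j.+1 (ltr0n _ 2))) mulrA -exprMn mulfV//.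
    by rewrite expr1n mul1r.
  have := modulusB (u + w) u; rewrite addrAC subrr add0r.
  by move: hd hle wE; lra.
have := hj (Num.truncn (b + 1)).+1.
have : b + 1 < (Num.truncn (b + 1)).+1%:R by rewrite truncnS_gt.
by set t := _%:R; lra.
Qed.

(** The uniform bound M of the truncated rows makes the contribution of the
    columns beyond n at most M times the l_p tail of y, for every N at once;
    hence the limits in N and in n may be interchanged. *)
Lemma row_representation (g : nat -> nat -> K) (gl : nat -> K) :
  (forall k, (fun N => g N k) @ \oo --> gl k) ->
  (forall y, lp p y -> cvgn (fun N => \sum_(0 <= k < N) g N k * y k)) ->
  exists2 M : R, 0 <= M & forall y, lp p y ->
    (fun n => \sum_(0 <= k < n) gl k * y k) @ \oo -->
      limn (fun N => \sum_(0 <= k < N) g N k * y k) /\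
    forall C, 0 <= C -> (lp_norm p y <= C%:E)%E ->
      modulus (limn (fun N => \sum_(0 <= k < N) g N k * y k)) <= M * C.
Proof.
move=> ggl hc.
have [M M0 hM] : exists2 M : R, 0 <= M &
    forall N, \sum_(0 <= k < N) modulus (g N k) `^ q <= M `^ q.
  apply: gliding_hump ggl _ => y /hc /cvg_bounded[B _ hB].
  by exists B.
have hM' n N : \sum_(n <= k < N) modulus (g N k) `^ q <= M `^ q.
  apply: le_trans (hM N); have [Nn|nN] := leqP N n.
    by rewrite big_geq// sumr_ge0// => k _; exact: powR_ge0.
  rewrite (@big_cat_nat _ _ _ n 0 N) ?(ltnW nN)//=.
  by rewrite lerDr sumr_ge0// => k _; exact: powR_ge0.
exists M => // y yl; split; last first.
  move=> C C0 yC; apply: modulus_lim_le (hc _ yl) _; exists 0%N => N _.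
  exact: finite_hoelder C0 M0 (hM N) ((lp_norm_leP y p0 C0).1 yC N).
have /lpP[C [C0 yC0]] := yl; have yC := (lp_norm_leP y p0 C0).1 yC0.
apply/cvg_modulusP => e e0.
(* The denominator is M + 1 because M may vanish. *)
pose d := e / (M + 1).
have M1 : 0 < M + 1 by rewrite ltr_wpDl.
have d0 : 0 < d by rewrite divr_gt0.
have [m hm] := bounded_sums_tail (fun k => powR_ge0 (modulus (y k)) p) yC (powR_gt0 p d0).
exists m => n mn; rewrite modulus_distrC; apply: (@le_trans _ _ (M * d)); last first.
  by rewrite /d mulrCA ger_pMr// ler_pdivrMr// mul1r lerDl.
apply: (@modulus_lim_le _ _
  (fun N => \sum_(0 <= k < N) g N k * y k - \sum_(0 <= k < n) g N k * y k)).
  apply: cvgB; first exact: hc.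
  exact: cvg_lincomb.
exists n => N nN; rewrite (@big_cat_nat _ _ _ n 0 N)//= addrAC subrr add0r.
exact: finite_hoelder (ltW d0) M0 (hM' n N) (hm n N mn).
Qed.
End Hump.

(** * Subset sums and the differences of a sequence *)

Section SubSums.
Variables (R : realType) (c : scalars).
Local Notation K := (scalar_field R c).
Implicit Types (z x : nat -> K).

Lemma sum_fset_filter (V : nmodType) (f : nat -> V) (P : pred nat) a b :
  \sum_(a <= n < b | P n) f n =
  \sum_(n <- [fset n in index_iota a b | P n]%fset) f n.
Proof.
rewrite -big_filter; apply: perm_big; apply: uniq_perm.
- by rewrite filter_uniq// iota_uniq.
- exact: fset_uniq.
- by move=> n; rewrite mem_filter !inE /= andbC.
Qed.

Lemma subsum_le z m N (B : R) (P : pred nat) : 0 <= B ->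
  (forall F, Fm m F -> modulus (\sum_(n <- F) z n) <= B) ->
  modulus (\sum_(m.+1 <= n < N | P n) z n) <= B.
Proof.
move=> B0 hF; rewrite sum_fset_filter; set F := [fset _ in _ | _]%fset.
have [->|F0] := eqVneq F fset0; first by rewrite big_seq_fset0 modulus0.
apply: hF; split=> // n; rewrite !inE/= mem_index_iota.
by move=> /andP[/andP[]].
Qed.

(** Splitting the indices by the sign of the real part bounds the sum of the
    |Re z_n| by two subset sums; the imaginary parts double this. *)
Lemma sum_modulus_le4 z m N (B : R) : 0 <= B ->
  (forall F, Fm m F -> modulus (\sum_(n <- F) z n) <= B) ->
  \sum_(m.+1 <= n < N) modulus (z n) <= 4 * B.
Proof.
move=> B0 hF.
have half (f : K -> R) : (forall s (P : pred nat),
    f (\sum_(n <- s | P n) z n) = \sum_(n <- s | P n) f (z n)) ->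
    (forall w, `|f w| <= modulus w) ->
    \sum_(m.+1 <= n < N) `|f (z n)| <= 2 * B.
  move=> fD fle; rewrite (bigID (fun n => 0 <= f (z n)))/=.
  have -> : \sum_(m.+1 <= n < N | 0 <= f (z n)) `|f (z n)| =
      f (\sum_(m.+1 <= n < N | 0 <= f (z n)) z n).
    by rewrite fD; apply: eq_bigr => n ?; rewrite ger0_norm.
  have -> : \sum_(m.+1 <= n < N | ~~ (0 <= f (z n))) `|f (z n)| =
      - f (\sum_(m.+1 <= n < N | ~~ (0 <= f (z n))) z n).
    rewrite fD -sumrN; apply: eq_bigr => n; rewrite -ltNge => ?.
    by rewrite ltr0_norm.
  rewrite mulr_natl mulr2n lerD//.
    by rewrite (le_trans (ler_norm _))// (le_trans (fle _))// subsum_le.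
  by rewrite (le_trans (ler_norm _))// normrN (le_trans (fle _))// subsum_le.
apply: (@le_trans _ _ (\sum_(m.+1 <= n < N)
    (`|re_part (z n)| + `|im_part (z n)|))).
  by apply: ler_sum => n _; exact: modulus_le_parts.
rewrite big_split/= (_ : 4 * B = 2 * B + 2 * B); last by ring.
apply: lerD; apply: half => //.
- by move=> s P; exact: re_part_sum.
- exact: re_part_le.
- by move=> s P; exact: im_part_sum.
- exact: im_part_le.
Qed.

Lemma fset_sum_le (u : nat -> R) m (B : R) : (forall n, 0 <= u n) ->
  (forall N, \sum_(m.+1 <= n < N) u n <= B) ->
  forall F, Fm m F -> \sum_(n <- F) u n <= B.
Proof.
move=> u0 hB F [_ Fm]; pose N := (\max_(n <- F) n).+1.
have -> : \sum_(n <- F) u n = \sum_(m.+1 <= n < N | n \in F) u n.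
  rewrite -[RHS]big_filter; apply: perm_big; apply: uniq_perm.
  - exact: fset_uniq.
  - by rewrite filter_uniq// iota_uniq.
  move=> n; rewrite mem_filter mem_index_iota; have [nF|//] := boolP (n \in F).
  rewrite Fm//= ltnS; apply/esym.
  by rewrite (big_rem n)//= leq_maxl.
apply: le_trans (hB N); rewrite [leRHS](bigID (mem F))/= lerDl.
by rewrite sumr_ge0.
Qed.

Lemma Delta_gt0 z n : (0 < n)%N -> Delta z n = z n - z n.-1.
Proof. by case: n. Qed.

Lemma DeltaB z x n : Delta (z - x) n = Delta z n - Delta x n.
Proof.
case: n => [|n]; rewrite /Delta /= !fctE; first by rewrite !subr0.
by rewrite !opprD !opprK addrACA.
Qed.

Definition partial_sums z : nat -> K := fun n => \sum_(0 <= i < n.+1) z i.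
Lemma Delta_partial_sums z : Delta (partial_sums z) = z.
Proof.
apply/funext => -[|n]; rewrite /Delta /partial_sums.
  by rewrite big_nat1 subr0.
by rewrite big_nat_recr//= addrAC subrr add0r.
Qed.

Lemma bv_tail z : carrier (bv R c) z -> forall e : R, 0 < e ->
  exists m, forall m' N, (m <= m')%N ->
    \sum_(m' <= n < N) modulus (Delta z n) <= e.
Proof.
move=> /lpP[C [C0 /(lp_norm1_leP _ C0) hC]].
by apply: bounded_sums_tail hC => n; exact: modulus_ge0.
Qed.

End SubSums.

(** * Tails of a matrix operator from l_p to bv *)

Section Operator.
Variables (R : realType) (c : scalars).
Local Notation K := (scalar_field R c).
Variables (p : R) (hp : 1 < p) (a : nat -> nat -> K).
Local Notation q := (p / (p - 1)).
Let p0 : 0 < p. Proof. exact: lt_trans ltr01 hp. Qed.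
Let q0 : 0 < q. Proof. exact: conj_exp_gt0. Qed.

Definition lp_space : normed_seq_space R c := NormedSeqSpace (lp p) (lp_norm p).
Hypothesis Ha : mx_class lp_space (bv R c) a.
Implicit Types (y z : nat -> K) (F : {fset nat}) (B C : R).

Local Notation incr F := (fun k => \sum_(n <- F) (a n k - a n.-1 k)).

Lemma row_cvg y n : lp p y ->
  (fun N => \sum_(0 <= k < N) a n k * y k) @ \oo --> mxapply a y n.
Proof. by move=> /Ha[+ _] => /(_ n). Qed.

(** The truncations of a single row form a family to which the uniform
    boundedness principle applies. *)
Lemma row_bounded n : exists2 M : R, 0 <= M & forall y C, 0 <= C ->
  (lp_norm p y <= C%:E)%E -> modulus (mxapply a y n) <= M * C.
Proof.
have [||M M0 hM] := row_representation hp (g := fun=> a n) (gl := a n).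
- by move=> k; exact: cvg_cst.
- by move=> y /row_cvg h; apply/cvg_ex; exists (mxapply a y n); exact: h.
exists M => // y C C0 yC; apply: (hM y _).2 => //.
by apply/lpP; exists C.
Qed.

(** Boundedness of each coordinate of the image of the unit sphere confines its
    first coordinates to a compact box. *)
Lemma Delta_row_bounded n : exists2 M : R, 0 <= M & forall y C, 0 <= C ->
  (lp_norm p y <= C%:E)%E -> modulus (Delta (mxapply a y) n) <= M * C.
Proof.
have [M M0 hM] := row_bounded n; case: n hM => [|n] hM.
  by exists M => // y C C0 yC; rewrite /Delta subr0; exact: hM.
have [M' M'0 hM'] := row_bounded n.
exists (M + M'); first exact: addr_ge0.
move=> y C C0 yC; rewrite /Delta (le_trans (modulusB _ _))// mulrDl.
by apply: lerD; [exact: hM|exact: hM'].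
Qed.

Lemma incr_cvg y F m : lp p y -> Fm m F ->
  (fun N => \sum_(0 <= k < N) incr F k * y k) @ \oo -->
  \sum_(n <- F) Delta (mxapply a y) n.
Proof.
move=> yl [_ hF].
have -> : \sum_(n <- F) Delta (mxapply a y) n =
    \sum_(n <- F) (mxapply a y n - mxapply a y n.-1).
  apply: eq_big_seq => n nF; apply: Delta_gt0.
  by apply: leq_ltn_trans (hF n nF).
elim: (enum_fset F) => [|n s IH].
  rewrite big_nil; apply: (@cvg_ev_cst _ _ _ _ 0) => N _.
  by rewrite big1// => k _; rewrite big_nil mul0r.
rewrite big_cons; under eq_fun => N.
  under eq_bigr do rewrite big_cons mulrDl mulrBl.
  rewrite big_split/= sumrB; over.
by apply: cvgD => //; apply: cvgB; exact: row_cvg.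
Qed.

Lemma sum_Delta_le y F m B C : 0 <= B -> 0 <= C -> Fm m F ->
  (lp_norm q (incr F) <= B%:E)%E -> (lp_norm p y <= C%:E)%E ->
  modulus (\sum_(n <- F) Delta (mxapply a y) n) <= B * C.
Proof.
move=> B0 C0 mF FB yC; apply: modulus_lim_le (incr_cvg _ mF) _.
  by apply/lpP; exists C.
exists 0%N => N _.
have hF := (lp_norm_leP _ q0 B0).1 FB N; have hy := (lp_norm_leP _ p0 C0).1 yC N.
exact: (finite_hoelder hp C0 B0 hF hy).
Qed.

(** Converse of the previous bound: if the norm exceeds B, so does the norm of
    some truncation, and its extremal vector has finite support, so that the
    series pairing reduces to a finite sum. *)
Lemma sum_Delta_attained F m B : 0 <= B -> Fm m F ->
  ~ (lp_norm q (incr F) <= B%:E)%E ->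
  exists y, [/\ lp p y, lp_norm p y = 1%E &
    B < modulus (\sum_(n <- F) Delta (mxapply a y) n)].
Proof.
move=> B0 mF nle.
have [N hN] : exists N, B `^ q < \sum_(0 <= k < N) modulus (incr F k) `^ q.
  apply: contrapT => nN; apply: nle; apply/(lp_norm_leP _ q0 B0) => N.
  by rewrite leNgt; apply/negP => h; apply: nN; exists N.
have [h [h0 h1 h2]] := dual_vector hp (le_lt_trans (powR_ge0 _ _) hN).
have hN1 : lp_norm p h = 1%E.
  by apply: (lp_norm_fin_supp (N := N)) => // k Nk; apply: h0; rewrite -leqNgt.
have hl : lp p h by apply/lpP; exists 1; rewrite hN1.
exists h; split => //.
rewrite (cvg_scalar_unique (incr_cvg hl mF) (l' := of_real c
  ((\sum_(0 <= k < N) modulus (incr F k) `^ q) `^ q^-1))).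
  rewrite modulus_of_real ger0_norm ?powR_ge0//.
  rewrite -[ltLHS](powRK_inv q0 B0); apply: gt0_ltr_powR; rewrite ?invr_gt0 ?nnegrE ?powR_ge0//.
  by rewrite (le_trans (powR_ge0 _ _) (ltW hN)).
apply: (@cvg_ev_cst _ _ _ _ N) => M NM; rewrite -h2.
rewrite (@big_cat_nat _ _ _ N 0 M)//= [X in _ + X]big_nat_cond [X in _ + X]big1 ?addr0// => k.
by rewrite andbT => /andP[Nk _]; rewrite h0 ?mulr0// -leqNgt.
Qed.

Lemma tail_supP m B : (tail_sup q a m <= B%:E)%E <->
  forall F, Fm m F -> (lp_norm q (incr F) <= B%:E)%E.
Proof.
split=> [h F mF|h]; first by apply: le_trans h; apply: ereal_sup_ubound; exists F.
by apply: ge_ereal_sup => _ [F mF <-]; exact: h.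
Qed.

Lemma tail_sup_ge0 m : (0 <= tail_sup q a m)%E.
Proof.
have mF : Fm m [fset m.+1]%fset.
  split; last by move=> n; rewrite inE => /eqP ->.
  by apply/fset0Pn; exists m.+1; rewrite inE.
apply: (le_trans (lp_norm_ge0 q (incr [fset m.+1]%fset))).
by apply: ereal_sup_ubound; exists [fset m.+1]%fset.
Qed.

Lemma tail_sup_nonincreasing : nonincreasing_seq (tail_sup q a).
Proof.
move=> m m' mm'; apply: ge_ereal_sup => _ [F [F0 hF] <-].
by apply: ereal_sup_ubound; exists F => //; split => // n /hF; exact: leq_ltn_trans.
Qed.

Lemma tail_sup_cvg : tail_sup q a @ \oo --> ereal_inf (range (tail_sup q a)).
Proof. exact: ereal_nonincreasing_cvgn tail_sup_nonincreasing. Qed.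

Lemma tail_Delta_le m B : 0 <= B -> (tail_sup q a m <= B%:E)%E ->
  forall y C, 0 <= C -> (lp_norm p y <= C%:E)%E ->
  forall N, \sum_(m.+1 <= n < N) modulus (Delta (mxapply a y) n) <= 4 * (B * C).
Proof.
move=> B0 /tail_supP hB y C C0 yC N; apply: sum_modulus_le4; first exact: mulr_ge0.
by move=> F mF; apply: sum_Delta_le mF (hB _ mF) yC.
Qed.

Lemma tail_sup_le m B : 0 <= B ->
  (forall y, lp p y -> lp_norm p y = 1%E ->
    forall N, \sum_(m.+1 <= n < N) modulus (Delta (mxapply a y) n) <= B) ->
  (tail_sup q a m <= B%:E)%E.
Proof.
move=> B0 h; apply/tail_supP => F mF; apply: contrapT => /(sum_Delta_attained B0 mF).
move=> [y [yl y1]]; rewrite ltNge => /negP; apply.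
apply: le_trans (modulus_sum _ _ _) _.
apply: fset_sum_le mF => [n|]; first exact: modulus_ge0.
exact: h.
Qed.

End Operator.

(** * Finite nets and comparison of finite sums *)

Section FiniteNets.
Variables (R : realType) (c : scalars).
Local Notation K := (scalar_field R c).

Lemma real_net (D d : R) : 0 < d -> exists s : seq R,
  forall x, `|x| <= D -> exists2 w, w \in s & `|x - w| <= d.
Proof.
move=> d0; exists [seq - D + d * j%:R | j <- iota 0 (Num.truncn (2 * D / d)).+1].
move=> x; rewrite ler_norml => /andP[x1 x2].
have xD0 : 0 <= (x + D) / d by rewrite divr_ge0 ?(ltW d0)// -lerBlDr sub0r.
have /andP[t1 t2] := truncn_itv xD0.
exists (- D + d * (Num.truncn ((x + D) / d))%:R).
  apply/mapP; eexists; last by [].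
  rewrite mem_iota/= add0n ltnS; apply: le_truncn.
  by rewrite ler_pM2r ?invr_gt0//; lra.
move: t1 t2; set t := Num.truncn _; rewrite ler_pdivlMr// ltr_pdivrMr// -addn1 natrD.
by move=> t1 t2; rewrite ler_norml; apply/andP; split; nra.
Qed.

Lemma scalar_net (D d : R) : 0 < d -> exists s : seq K,
  forall x, modulus x <= D -> exists2 w, w \in s & modulus (x - w) <= d.
Proof.
move=> d0; have d2 : 0 < d / 2 by rewrite divr_gt0.
have [s hs] := real_net D d2; exists [seq of_parts c a b | a <- s, b <- s].
move=> x xD.
have [a sa ha] := hs _ (le_trans (re_part_le x) xD).
have [b sb hb] := hs _ (le_trans (im_part_le x) xD).
exists (of_parts c a b); first exact: allpairs_f.
by apply: le_trans (modulus_sub_of_parts _ _ _) _; lra.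
Qed.

(** The net points are stored as lists, read with default value 0, so that a net
    in dimension m + 1 is the product of a net of scalars and one in
    dimension m. *)
Lemma box_net (m : nat) (D d : R) : 0 < d -> exists s : seq (seq K),
  forall z : nat -> K, (forall k, (k < m)%N -> modulus (z k) <= D) ->
  exists2 w, w \in s & forall k, (k < m)%N -> modulus (z k - nth 0 w k) <= d.
Proof.
move=> d0; elim: m => [|m [s hs]].
  by exists [:: [::]] => z _; exists [::].
have [s1 hs1] := scalar_net D d0; exists [seq x :: w | x <- s1, w <- s] => z zD.
have [x xs hx] := hs1 _ (zD 0%N isT).
have [|w ws hw] := hs (fun k => z k.+1); first by move=> k km; exact: (zD k.+1 km).
by exists (x :: w); [exact: allpairs_f|case].
Qed.

Lemma split_sum_le (u : nat -> R) m (A B : R) : (forall k, 0 <= u k) ->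
  \sum_(0 <= k < m) u k <= A -> (forall N, \sum_(m <= k < N) u k <= B) ->
  forall N, \sum_(0 <= k < N) u k <= A + B.
Proof.
move=> u0 hA hB N; have B0 := hB 0%N; rewrite big_geq// in B0.
have [Nm|mN] := leqP N m.
  rewrite (@big_cat_nat _ _ _ N 0 m)//= in hA.
  apply: le_trans (_ : A <= _); last by rewrite lerDl.
  by apply: le_trans hA; rewrite lerDl sumr_ge0.
by rewrite (@big_cat_nat _ _ _ m 0 N) ?(ltnW mN)//= lerD.
Qed.

Lemma sub_sum_le (u : nat -> R) m N : (forall k, 0 <= u k) ->
  \sum_(m <= k < N) u k <= \sum_(0 <= k < N) u k.
Proof.
move=> u0; have [Nm|mN] := leqP N m; first by rewrite big_geq// sumr_ge0.
by rewrite (@big_cat_nat _ _ _ m 0 N) ?(ltnW mN)//= lerDr sumr_ge0.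
Qed.

Lemma sum_modulus_le_dist (x y : nat -> K) m N :
  \sum_(m <= k < N) modulus (x k) <=
  \sum_(m <= k < N) modulus (x k - y k) + \sum_(m <= k < N) modulus (y k).
Proof.
rewrite -big_split/=; apply: ler_sum => k _; rewrite addrC.
exact: modulus_le_of_dist.
Qed.

End FiniteNets.

(** * The two bounds for the measure of noncompactness *)

Section Noncompactness.
Variables (R : realType) (c : scalars).
Local Notation K := (scalar_field R c).
Variables (p : R) (hp : 1 < p) (a : nat -> nat -> K).
Local Notation q := (p / (p - 1)).
Hypothesis Ha : mx_class (lp_space c p) (bv R c) a.
Local Notation sigma := (tail_sup q a).

Lemma tail_sup_lim : limn sigma = ereal_inf (range sigma).
Proof. by apply: cvg_lim; [exact: ereal_hausdorff|exact: tail_sup_cvg]. Qed.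

(** Beyond an index where all the finitely many centres have tail at most d, an
    image point within e of a centre has tail at most e + d. *)
Lemma tail_sup_lim_le_chi :
  (limn sigma <= op_chi (lp_space c p) (bv R c) (mxapply a))%E.
Proof.
rewrite tail_sup_lim; apply: le_ereal_inf_tmp => _ [e [e0 [n [x [rad [hx cover]]]]] <-].
apply/lee_addgt0Pr => d d0.
have /choice[mi hmi] i : exists m, (i <= n)%N -> forall m' N, (m <= m')%N ->
    \sum_(m' <= k < N) modulus (Delta (x i) k) <= d.
  have [ni|ni] := leqP i n; last by exists 0%N.
  by have [m hm] := bv_tail (hx i ni).1 d0; exists m.
pose m := \max_(i < n.+1) mi i.
have mim i : (i <= n)%N -> (mi i <= m.+1)%N.
  move=> ni; rewrite leqW//.
  exact: (@leq_bigmax _ (fun i : 'I_n.+1 => mi i) (Ordinal (ni : (i < n.+1)%N))).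
apply: le_trans (ereal_inf_lbound (imageT sigma m)) _; rewrite -EFinD.
apply: tail_sup_le => //; first by rewrite addr_ge0// ltW.
move=> y yl y1 N; have [|i ni [_ /lp_norm_ltP[D [D0 Drad hD]]]] := cover (mxapply a y).
  by exists y.
have {}hD := (lp_norm1_leP _ D0).1 hD.
apply: le_trans (sum_modulus_le_dist _ (Delta (x i)) _ _) _.
apply: lerD; last exact: hmi (mim i ni).
apply: le_trans (sub_sum_le _ _ (fun k => modulus_ge0 _)) _.
under eq_bigr do rewrite -DeltaB.
apply: le_trans (hD N) _; apply: ltW; apply: lt_trans Drad _.
by have /andP[] := (hx i ni).2.
Qed.

(** The centres are the sequences whose differences are net points up to m and
    vanish afterwards.  With d the allowed excess, the net costs d/8 in total
    and the tail 4 (L + d/8), which together stay below the radius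
    4 L + 7d/8, itself smaller than 4 L + d. *)
Lemma chi_le_tail_sup_lim :
  (op_chi (lp_space c p) (bv R c) (mxapply a) <= 4%:E * limn sigma)%E.
Proof.
rewrite tail_sup_lim; have : (0 <= ereal_inf (range sigma))%E.
  by apply: le_ereal_inf_tmp => _ [m _ <-]; exact: tail_sup_ge0.
case E : (ereal_inf _) => [L| |]//; last by rewrite gt0_muley ?leey.
rewrite lee_fin => L0; apply/lee_addgt0Pr => d d0.
have [|_ [m _ <-] hm] := @ereal_inf_lt _ (range sigma) (L + d / 8)%:E.
  by rewrite E lte_fin; lra.
have b0 : 0 <= L + d / 8 by lra.
have tail := tail_Delta_le hp Ha b0 (ltW hm).
have /choice[M hM] n : exists M : R, 0 <= M /\ forall y, (lp_norm p y <= 1%:E)%E ->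
    modulus (Delta (mxapply a y) n) <= M.
  have [M M0 hM] := Delta_row_bounded hp Ha n; exists M; split => // y y1.
  by have := hM y 1 ler01 y1; rewrite mulr1.
pose D := \sum_(0 <= n < m.+1) M n.
have MD n : (n < m.+1)%N -> M n <= D.
  move=> nm; rewrite /D (bigD1_seq n) ?mem_index_iota ?iota_uniq//= lerDl.
  by rewrite sumr_ge0// => i _; have [] := hM i.
pose del := d / 8 / m.+1%:R.
have del0 : 0 < del by rewrite !divr_gt0.
have [s hs] := @box_net _ c m.+1 D del del0.
pose center i : nat -> K := fun k => if (k < m.+1)%N then nth 0 (nth [::] s i) k else 0.
have EL : (4%:E * L%:E + d%:E = (4 * L + d)%:E)%E by rewrite -EFinM -EFinD.
rewrite EL; apply: ereal_inf_lbound; exists (4 * L + d) => //; split; first by lra.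
exists (size s), (fun i => partial_sums (center i)), (fun=> 4 * L + 7 / 8 * d).
split.
  move=> i _; split; last by apply/andP; split; lra.
  apply/lpP; pose B := \sum_(0 <= k < m.+1) modulus (center i k).
  have B0 : 0 <= B by rewrite sumr_ge0// => k _; exact: modulus_ge0.
  exists B; split=> //; apply/lp_norm1_leP => // N.
  rewrite Delta_partial_sums -[leRHS]addr0; apply: (split_sum_le (m := m.+1)) => //.
    by move=> k; exact: modulus_ge0.
  move=> N'; rewrite big_nat_cond big1// => k; rewrite andbT => /andP[mk _].
  by rewrite /center ltnNge mk modulus0.
move=> _ [y [yl y1] <-].
have y1' : (lp_norm p y <= 1%:E)%E by move: y1 => /= ->.
have [|w ws hw] := hs (Delta (mxapply a y)).
  by move=> k km; apply: le_trans (MD k km); exact: (hM k).2.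
exists (index w s); first by rewrite /= index_size.
have cE k : center (index w s) k = if (k < m.+1)%N then nth 0 w k else 0.
  by rewrite /center nth_index.
have tot N : \sum_(0 <= k < N) modulus (Delta (mxapply a y - partial_sums (center (index w s))) k)
    <= d / 8 + 4 * (L + d / 8).
  apply: (split_sum_le (m := m.+1)); first by move=> k; exact: modulus_ge0.
    apply: (@le_trans _ _ (\sum_(0 <= k < m.+1) del)).
      rewrite big_nat [leRHS]big_nat; apply: ler_sum => k /andP[_ km].
      by rewrite DeltaB Delta_partial_sums cE km; exact: hw.
    by rewrite sumr_const_nat subn0 -[leLHS]mulr_natr /del mulfVK ?pnatr_eq0.
  move=> N'; rewrite (eq_big_nat _ _ (F2 := fun k => modulus (Delta (mxapply a y) k))).
    by have := tail y 1 ler01 y1' N'; rewrite mulr1.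
  move=> k /andP[mk _].
  by rewrite DeltaB Delta_partial_sums cE ltnNge mk subr0.
have T0 : 0 <= d / 8 + 4 * (L + d / 8) by lra.
have hT : (snorm (bv R c) (mxapply a y - partial_sums (center (index w s)))%R
    <= (d / 8 + 4 * (L + d / 8))%:E)%E by apply/lp_norm1_leP.
split; last by apply: le_lt_trans hT _; rewrite lte_fin; lra.
by have [] := Ha yl.
Qed.

End Noncompactness.

(** * Compactness *)

Section UltraLimits.
Variables (R : realType) (c : scalars).
Local Notation K := (scalar_field R c).
Variables (U : set_system nat) (FU : UltraFilter U).

(** The limit is the supremum of the levels a for which h >= a holds along the
    ultrafilter; maximality decides every level above it. *)
Lemma ultra_lim_real (h : nat -> R) (B : R) : (forall i, `|h i| <= B) ->
  exists l, forall e, 0 < e -> U [set i | `|h i - l| <= e].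
Proof.
move=> hB; pose S := [set a : R | U [set i | a <= h i]].
have SB : ubound S B.
  move=> a /filter_ex[i /= ai]; apply: le_trans ai _.
  exact: le_trans (ler_norm _) (hB i).
have hs : has_sup S.
  split; last by exists B.
  exists (- B); rewrite /S/=; apply: filterS filterT => i _ /=.
  by have := hB i; rewrite ler_norml => /andP[].
exists (sup S) => e e0.
have [b Sb hb] := sup_adherent e0 hs.
have hU : U (~` [set i | sup S + e <= h i]).
  have [h1|//] := in_ultra_setVsetC [set i | sup S + e <= h i] FU.
  have := ub_le_sup hs.2 h1; lra.
apply: filterS (filterI Sb hU) => i /= [h1 /negP]; rewrite -ltNge => h2.
by rewrite ler_norml; apply/andP; split; lra.
Qed.

Lemma ultra_lim (h : nat -> K) (B : R) : (forall i, modulus (h i) <= B) ->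
  exists l, forall e : R, 0 < e -> U [set i | modulus (h i - l) <= e].
Proof.
move=> hB.
have [l hl] := @ultra_lim_real (fun i => re_part (h i)) B
  (fun i => le_trans (re_part_le _) (hB i)).
have [l' hl'] := @ultra_lim_real (fun i => im_part (h i)) B
  (fun i => le_trans (im_part_le _) (hB i)).
exists (of_parts c l l') => e e0; have e2 : 0 < e / 2 by rewrite divr_gt0.
apply: filterS (filterI (hl _ e2) (hl' _ e2)) => i /= [h1 h2].
by apply: le_trans (modulus_sub_of_parts _ _ _) _; lra.
Qed.

Lemma ultra_sum_small (w : nat -> nat -> K) (l : nat -> K) N :
  (forall n (e : R), 0 < e -> U [set i | modulus (w i n - l n) <= e]) ->
  forall e : R, 0 < e ->
  U [set i | \sum_(0 <= n < N) modulus (w i n - l n) <= e].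
Proof.
move=> hl; elim: N => [|N IH] e e0.
  by apply: filterS filterT => i _ /=; rewrite big_geq// ltW.
have e2 : 0 < e / 2 by rewrite divr_gt0.
apply: filterS (filterI (IH _ e2) (hl N _ e2)) => i /= [h1 h2].
by rewrite big_nat_recr//=; lra.
Qed.

End UltraLimits.

Section Compactness.
Variables (R : realType) (c : scalars).
Local Notation K := (scalar_field R c).
Variables (p : R) (hp : 1 < p) (a : nat -> nat -> K).
Local Notation q := (p / (p - 1)).
Hypothesis Ha : mx_class (lp_space c p) (bv R c) a.
Local Notation sigma := (tail_sup q a).

Lemma tail_sup_lim_ge0 : (0 <= limn sigma)%E.
Proof.
rewrite tail_sup_lim; apply: le_ereal_inf_tmp => _ [m _ <-].
exact: tail_sup_ge0.
Qed.

(** A single ultrafilter gives limits of all the coordinates at once, which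
    replaces a diagonal extraction.  The uniform tails turn these limits into a
    norm limit along the ultrafilter, whose members are infinite sets; a
    subsequence is then picked one index at a time. *)
Lemma compact_of_tail_sup : limn sigma = 0%E ->
  compact_op (lp_space c p) (bv R c) (mxapply a).
Proof.
rewrite tail_sup_lim => s0; split=> [x /Ha[]//|z zl [C hC]].
have C0 : 0 <= C by have := le_trans (lp_norm_ge0 _ _) (hC 0%N); rewrite lee_fin.
pose w i := Delta (mxapply a (z i)).
have wtail (e : R) : 0 < e -> exists m, forall i N, \sum_(m <= n < N) modulus (w i n) <= e.
  move=> e0; pose B := e / (4 * (C + 1)).
  have C1 : 0 < 4 * (C + 1) by lra.
  have B0 : 0 < B by rewrite divr_gt0.
  have [|_ [m _ <-] hm] := @ereal_inf_lt _ (range sigma) B%:E.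
    by rewrite s0 lte_fin.
  exists m.+1 => i N.
  apply: le_trans (tail_Delta_le hp Ha (ltW B0) (ltW hm) C0 (hC i) N) _.
  have : B * (4 * (C + 1)) = e by rewrite mulfVK ?gt_eqF.
  by nra.
have [U [FU sU]] := ultraFilterLemma (eventually_filter).
have /choice[l hl] n : exists l : K, forall e : R, 0 < e ->
    U [set i | modulus (w i n - l) <= e].
  have [M M0 hM] := Delta_row_bounded hp Ha n.
  by apply: (@ultra_lim _ _ U FU (fun i => w i n) (M * C)) => i; exact: hM _ _ C0 (hC i).
have hsum N := ultra_sum_small FU N hl.
(* The limit sequence inherits the tail bounds that are uniform in i. *)
have ltail (e : R) m : (forall i N, \sum_(m <= n < N) modulus (w i n) <= e) ->
    forall N, \sum_(m <= n < N) modulus (l n) <= e.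
  move=> he N; apply/ler_addgt0Pr => d d0.
  have /filter_ex[i /= hi] := hsum N d d0.
  apply: le_trans (sum_modulus_le_dist _ (w i) _ _) _; rewrite addrC lerD//.
  apply: le_trans hi; apply: le_trans (sub_sum_le _ _ (fun k => modulus_ge0 _)) _.
  by apply: ler_sum => k _; rewrite modulus_distrC.
have hnorm (e : R) : 0 < e ->
    U [set i | forall N, \sum_(0 <= n < N) modulus (w i n - l n) <= e].
  move=> e0; have e4 : 0 < e / 4 by rewrite divr_gt0.
  have e2 : 0 < e / 2 by rewrite divr_gt0.
  have [m hm] := wtail _ e4.
  apply: filterS (hsum m _ e2) => i /= hi N.
  rewrite (_ : e = e / 2 + (e / 4 + e / 4)); last by field.
  apply: (split_sum_le (fun k => modulus_ge0 (w i k - l k)) hi) => N'.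
  apply: le_trans (lerD (hm i N') (ltail _ _ hm N')).
  by rewrite -big_split/=; apply: ler_sum => k _; exact: modulusB.
pose y := partial_sums l.
have hy (e : R) : 0 < e -> U [set i | (snorm (bv R c) (mxapply a (z i) - y)%R <= e%:E)%E].
  move=> e0; apply: filterS (hnorm e e0) => i /= hi; apply/lp_norm1_leP; first exact: ltW.
  by move=> N; under eq_bigr do rewrite DeltaB Delta_partial_sums.
have ybv : carrier (bv R c) y.
  have /filter_ex[i /= hi] := hnorm 1 ltr01.
  have /lpP[D [D0 /(lp_norm1_leP _ D0) hD]] := (Ha (zl i)).2.
  apply/lpP; exists (1 + D); split; first by rewrite addr_ge0.
  apply/lp_norm1_leP => [|N]; first by rewrite addr_ge0.
  rewrite Delta_partial_sums; apply: le_trans (sum_modulus_le_dist _ (w i) _ _) _.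
  apply: lerD (hD N); apply: le_trans (hi N).
  by apply: ler_sum => k _; rewrite modulus_distrC.
have /choice[next hnext] (jk : nat * nat) : exists i, (jk.2 < i)%N /\
    (snorm (bv R c) (mxapply a (z i) - y)%R <= (jk.1.+1%:R^-1)%:E)%E.
  have hU : U [set i | (jk.2 < i)%N] by apply: sU; exists jk.2.+1.
  have j0 : 0 < jk.1.+1%:R^-1 :> R by rewrite invr_gt0.
  have hUU : U ([set i | (jk.2 < i)%N] `&`
      [set i | (snorm (bv R c) (mxapply a (z i) - y)%R <= (jk.1.+1%:R^-1)%:E)%E]).
    by apply: filterI => //; exact: hy.
  have [i [h1 h2]] := filter_ex hUU.
  by exists i.
pose phi := fix phi j := if j is i.+1 then next (j, phi i) else next (0%N, 0%N).
exists phi; split.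
  apply: homo_ltn => [j i k|j]; first exact: ltn_trans.
  by have [] := hnext (j.+1, phi j).
exists y => //.
have phiE j : (snorm (bv R c) (mxapply a (z (phi j)) - y)%R <= (j.+1%:R^-1)%:E)%E.
  by case: j => [|j]; [have [] := hnext (0%N, 0%N)|have [] := hnext (j.+1, phi j)].
apply: (@squeeze_cvge _ _ _ _ (fun=> 0%E) _ (fun j => (j.+1%:R^-1)%:E)).
- by apply: nearW => j; rewrite phiE andbT; exact: lp_norm_ge0.
- exact: cvg_cst.
- by apply: cvg_EFin; [exact: nearW|exact: cvg_harmonic].
Qed.

(** If the limit exceeds e, each m has a unit vector whose image has tail beyond
    m larger than e.  A norm limit w of a subsequence of the images would have
    small tails and be close to them, which bounds their tails by e. *)
Lemma tail_sup_of_compact : compact_op (lp_space c p) (bv R c) (mxapply a) ->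
  limn sigma = 0%E.
Proof.
move=> [_ hcomp]; apply/eqP; rewrite eq_le tail_sup_lim_ge0 andbT.
rewrite leNgt; apply/negP => s0.
have [e e0 he] : exists2 e : R, 0 < e & forall m, ~ (sigma m <= e%:E)%E.
  have [e e0 he] : exists2 e : R, 0 < e & (e%:E < limn sigma)%E.
    move: s0; case: (limn sigma) => [L| |]//; last by exists 1; rewrite ?ltry.
    by rewrite lte_fin => L0; exists (L / 2); rewrite ?lte_fin; lra.
  exists e => // m; apply/negP; rewrite -ltNge; apply: lt_le_trans he _.
  by rewrite tail_sup_lim; exact: ereal_inf_lbound.
have /choice[z hz] m : exists y, [/\ lp p y, lp_norm p y = 1%E &
    exists N, e < \sum_(m.+1 <= n < N) modulus (Delta (mxapply a y) n)].
  apply: contrapT => nex; apply: (he m); apply: tail_sup_le (ltW e0) _ => // y yl y1 N.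
  by rewrite leNgt; apply/negP => hN; apply: nex; exists y; split=> //; exists N.
have [i||phi [phi_homo [w wbv hw]]] := hcomp z; first by have [] := hz i.
  by exists 1 => i; have [_ h _] := hz i; rewrite /= h.
have e2 : 0 < e / 2 by rewrite divr_gt0.
have [m hm] := bv_tail wbv e2.
have : \forall i \near \oo, (snorm (bv R c) (mxapply a (z (phi i)) - w)%R < (e / 2)%:E)%E.
  apply: (hw [set x | (x < (e / 2)%:E)%E]); apply: open_nbhs_nbhs.
  by split; [exact: open_ereal_lt_ereal|rewrite /= lte_fin].
move=> [m' _ hm']; pose i := maxn m m'.
have phi_ge j : (j <= phi j)%N.
  by elim: j => // j IH; apply: leq_ltn_trans IH (phi_homo _ _ (ltnSn j)).
have [_ _ [N]] := hz (phi i); rewrite ltNge => /negP; apply.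
apply: le_trans (sum_modulus_le_dist _ (Delta w) _ _) _.
rewrite (_ : e = e / 2 + e / 2); last by field.
apply: lerD; last first.
  by apply: hm; rewrite leqW// (leq_trans (leq_maxl m m'))// phi_ge.
have /ltW/lp_norm1_leP := hm' i (leq_maxr m m').
move=> /(_ (ltW e2) N); apply: le_trans.
apply: le_trans (sub_sum_le _ _ (fun k => modulus_ge0 _)) _.
by apply: ler_sum => k _; rewrite DeltaB.
Qed.

End Compactness.

(** * Convolution inverses and the Toeplitz determinants *)

Section Convolution.
Variable (F : fieldType).
Implicit Types (a b d : nat -> F).

Definition conv a b : nat -> F := fun n => \sum_(0 <= i < n.+1) a i * b (n - i)%N.
Definition conv_unit : nat -> F := fun n => (n == 0)%:R.

(** A term of a convolution depends on finitely many terms of its factors, so the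
    ring laws can be read off products of polynomials. *)
Lemma conv_poly a b N n : (n < N)%N ->
  conv a b n = (\poly_(i < N) a i * \poly_(i < N) b i)`_n.
Proof.
move=> nN; rewrite coefM /conv big_mkord; apply: eq_bigr => -[i /= ni] _.
rewrite !coef_poly (leq_trans ni)// (leq_ltn_trans (leq_subr _ _))//.
Qed.

Lemma convC a b : conv a b = conv b a.
Proof.
by apply/funext => n; rewrite !(conv_poly _ _ (ltnSn n)) mulrC.
Qed.

Lemma convA a b d : conv a (conv b d) = conv (conv a b) d.
Proof.
have half a' b' d' n : conv a' (conv b' d') n =
    (\poly_(i < n.+1) a' i * (\poly_(i < n.+1) b' i * \poly_(i < n.+1) d' i))`_n.
  rewrite coefM /conv big_mkord; apply: eq_bigr => -[i /= ni] _.
  rewrite coef_poly ni; congr (_ * _).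
  by rewrite -(conv_poly _ _ (_ : (n - i < n.+1)%N))// ltnS leq_subr.
apply/funext => n; rewrite half mulrA mulrC.
by rewrite convC half; congr (_`_n); ring.
Qed.

Lemma conv_unitr a : conv a conv_unit = a.
Proof.
apply/funext => n; rewrite /conv big_nat_recr//= subnn /conv_unit eqxx mulr1.
rewrite big_nat big1 ?add0r// => i /andP[_ ni].
by rewrite subn_eq0 leqNgt ni mulr0.
Qed.

Lemma convK a b d : conv b d = conv_unit -> conv (conv a b) d = a.
Proof. by move=> bd; rewrite -convA bd conv_unitr. Qed.

(** The n-th term of the inverse is determined by the earlier ones, so the
    recursion runs over the list of the terms found so far. *)
Lemma conv_inverse_ex (s : nat -> F) : s 0%N != 0 ->
  exists e, conv s e = conv_unit.
Proof.
move=> s0.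
pose next (l : seq F) : F := (s 0%N)^-1 *
  ((size l == 0)%:R - \sum_(0 <= i < size l) s i.+1 * nth 0 l (size l - i.+1)%N).
pose pre := fix pre n := if n is m.+1 then rcons (pre m) (next (pre m)) else [::].
have size_pre n : size (pre n) = n by elim: n => //= n IH; rewrite size_rcons IH.
pose e n := next (pre n).
have pre_nth n i : (i < n)%N -> nth 0 (pre n) i = e i.
  elim: n => // n IH; rewrite ltnS leq_eqVlt /= nth_rcons size_pre.
  by move=> /predU1P[->|ni]; [rewrite ltnn eqxx | rewrite ni IH].
exists e; apply/funext => n; rewrite /conv big_nat_recl//= subn0.
rewrite {1}/e /next size_pre mulVKf// /conv_unit.
rewrite [X in _ - X + _](_ : _ = \sum_(0 <= i < n) s i.+1 * e (n - i.+1)%N) ?subrK//.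
rewrite !big_nat; apply: eq_bigr => i /andP[_ ni].
by rewrite pre_nth// ltn_subrL (leq_ltn_trans _ ni).
Qed.

(** The first n + 1 terms of e solve a lower triangular Toeplitz system S e = e_0
    with determinant s_0^(n+1).  Cramer's rule gives e_n as the cofactor of S at
    row 0 and column n, and the corresponding minor is exactly the Hessenberg
    matrix that defines D_n. *)
Lemma conv_inverse_det (s e : nat -> F) n : s 0%N != 0 -> conv s e = conv_unit ->
  e n = (-1) ^+ n * (s 0%N ^- n.+1 *
    \det (\matrix_(i < n, j < n) if (j <= i.+1)%N then s (i.+1 - j)%N else 0)).
Proof.
move=> s0 se.
pose S : 'M[F]_n.+1 := \matrix_(i, j) if (j <= i)%N then s (i - j)%N else 0.
pose E : 'cV[F]_n.+1 := \col_i e i.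
have SE : S *m E = delta_mx 0 0.
  apply/colP => i; rewrite !mxE eqxx andbT.
  transitivity (conv e s i); last by rewrite convC se.
  rewrite /conv big_mkord.
  rewrite (big_ord_widen n.+1 (fun k => e k * s (i - k)%N))//.
  rewrite [RHS]big_mkcond; apply: eq_bigr => k _; rewrite !mxE ltnS.
  by case: ifP => _; rewrite ?mul0r// mulrC.
have detS : \det S = s 0%N ^+ n.+1.
  rewrite det_trig; last first.
    by apply/is_trig_mxP => i j ij; rewrite mxE leqNgt ij.
  by under eq_bigr do rewrite mxE leqnn subnn; rewrite prodr_const card_ord.
have := congr1 (mulmx (\adj S)) SE.
rewrite mulmxA mul_adj_mx mul_scalar_mx => /matrixP/(_ ord_max 0).
rewrite !mxE (bigD1 0)//= !mxE !eqxx big1 ?addr0 ?mulr1; last first.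
  by move=> i i0; rewrite !mxE (negbTE i0) mulr0.
rewrite detS /cofactor add0n => h.
rewrite mulrCA; apply: (mulfI (expf_neq0 n.+1 s0)); rewrite h mulVKf ?expf_neq0//.
congr (_ * \det _); apply/matrixP => i j; rewrite !mxE lift0 lift_max.
by [].
Qed.

Definition band_seq (u v : F) : nat -> F :=
  fun m => if m is 0 then u else if m is 1 then v else 0.
Definition band_inv_seq (u v : F) : nat -> F := fun m => (- v) ^+ m / u ^+ m.+1.

Lemma conv_band_inv (u v : F) : u != 0 ->
  conv (band_seq u v) (band_inv_seq u v) = conv_unit.
Proof.
move=> hu; apply/funext => -[|n]; rewrite /conv /conv_unit.
  by rewrite big_nat1 /band_inv_seq /= expr0 expr1 mul1r mulfV.
rewrite big_nat_recl// big_nat_recl//= big1 ?addr0; last by move=> i _; rewrite mul0r.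
rewrite /band_inv_seq subSS !subn0 exprS [u ^+ n.+2]exprS invfM.
rewrite (_ : u * _ = - (v * ((- v) ^+ n / u ^+ n.+1))) ?addNr//.
by rewrite mulrCA mulrA -(mulrA _ u) mulVKf// !mulNr mulrA.
Qed.

End Convolution.

(** * Identification of the transformed matrix *)

Lemma triangle_exchange (V : nmodType) (f : nat -> nat -> V) a N :
  \sum_(a <= j < N) \sum_(a <= i < j.+1) f i j =
  \sum_(a <= i < N) \sum_(i <= j < N) f i j.
Proof.
have [Na|/ltnW aN] := leqP N a; first by rewrite !big_geq.
rewrite -(subnKC aN); elim: (N - a)%N => [|d IH].
  by rewrite addn0 !big_geq.
rewrite addnS big_nat_recr ?leq_addr//= IH [in RHS]big_nat_recr ?leq_addr//=.
rewrite [in LHS]big_nat_recr ?leq_addr//= addrA; congr (_ + _); last by rewrite big_nat1.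
rewrite -big_split/= big_nat [RHS]big_nat; apply: eq_bigr => i /andP[_ ia].
by rewrite big_nat_recr ?(ltnW ia).
Qed.

Lemma big_two (V : nmodType) (f : nat -> V) k :
  \sum_(k <= i < k.+2) f i = f k + f k.+1.
Proof. by rewrite big_nat_recr//= big_nat1. Qed.

Section DoubleLimits.
Variables (R : realType) (c : scalars).
Local Notation K := (scalar_field R c).

(** The joint limit exists, and the iterated limit must agree with it.  This is
    where rectangular convergence matters: the truncation of a row of A yields
    the diagonal partial sums, while [tilde_mx] is an iterated sum. *)
Lemma pringsheim_diagonal (f : nat -> nat -> K) (g : nat -> K) (l : K) :
  cvg ((fun MN : nat * nat => f MN.1 MN.2) @ filter_prod \oo \oo) ->
  (forall M, (fun N => f M N) @ \oo --> g M) -> g @ \oo --> l ->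
  (fun N => f N N) @ \oo --> l.
Proof.
move=> /cvg_ex[P hP] fg gl.
have joint (e : R) : 0 < e -> exists m, forall M N, (m <= M)%N -> (m <= N)%N ->
    modulus (f M N - P) <= e.
  move=> e0; have e0' : 0 < of_real c e by rewrite -(of_real0 _ c) of_real_lt.
  have /cvgrPdist_le/(_ _ e0') := hP.
  move=> [[A B] /= [[m1 _ h1] [m2 _ h2]] AB].
  exists (maxn m1 m2) => M N; rewrite !geq_max => /andP[M1 M2] /andP[N1 N2].
  have /= := AB (M, N) (conj (h1 M M1) (h2 N N2)).
  by rewrite -of_real_modulus of_real_le modulus_distrC.
have gP : g @ \oo --> P.
  apply/cvg_modulusP => e e0; have [m hm] := joint e e0; exists m => M mM.
  apply: (@modulus_lim_le _ _ (fun N => f M N - P)).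
    by apply: cvgB => //; exact: cvg_cst.
  by exists m => N mN; exact: hm.
rewrite (cvg_scalar_unique gl gP); apply/cvg_modulusP => e e0.
by have [m hm] := joint e e0; exists m => N mN; exact: hm.
Qed.

Lemma mxapply_triangle (L : nat -> nat -> K) x n :
  (forall k, (n < k)%N -> L n k = 0) ->
  mxapply L x n = \sum_(0 <= k < n.+1) L n k * x k.
Proof.
move=> L0; apply/cvg_lim => //; apply: (@cvg_ev_cst _ _ _ _ n.+1) => N nN.
rewrite (@big_cat_nat _ _ _ n.+1 0 N)//= [X in _ + X]big_nat_cond [X in _ + X]big1 ?addr0// => k.
by rewrite andbT => /andP[nk _]; rewrite L0// mul0r.
Qed.

End DoubleLimits.

Section Triangle.
Variables (R : realType) (c : scalars).
Local Notation K := (scalar_field R c).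
Variables (p : R) (r s t : nat -> K) (u v : K).
Hypotheses (hp : 1 < p) (hr : forall n, r n != 0) (ht : forall n, t n != 0)
  (hs : s 0%N != 0) (hu : u != 0).
Implicit Types x y : nat -> K.

Local Notation band_seq := (band_seq u v).
Local Notation band_inv_seq := (band_inv_seq u v).
Local Notation T := (mxapply (mxprod (mean_mx r s t) (band_mx u v))).

Lemma mxprod_mean_band n k : mxprod (mean_mx r s t) (band_mx u v) n k =
  \sum_(0 <= j < n.+1) mean_mx r s t n j * band_mx u v j k.
Proof.
apply: (@mxapply_triangle _ _ (mean_mx r s t) (fun j => band_mx u v j k)).
by move=> j nj; rewrite /mean_mx leqNgt nj.
Qed.

(** Up to the diagonal factors t and 1/r, both matrices are convolutions. *)
Lemma mean_bandE x n :
  T x n = conv (fun j => t j * conv x band_seq j) s n / r n.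
Proof.
have bandE j k : (k <= j)%N -> band_mx u v j k = band_seq (j - k)%N.
  move=> kj; rewrite /band_mx; have [->|kj'] := eqVneq k j; first by rewrite subnn.
  have {kj kj'}kj : (k < j)%N by rewrite ltn_neqAle kj' kj.
  rewrite -(subnSK kj) eqn_leq kj -subn_eq0 /=.
  by case: (j - k.+1)%N.
have band0 j k : (j < k)%N -> band_mx u v j k = 0.
  by move=> jk; rewrite /band_mx gtn_eqF// gtn_eqF// leqW.
rewrite mxapply_triangle => [|k nk]; last first.
  rewrite mxprod_mean_band big_nat big1// => j /andP[_ jn].
  by rewrite band0 ?mulr0// (leq_trans jn).
under eq_bigr do rewrite mxprod_mean_band mulr_suml.
rewrite exchange_big/= {1}/conv mulr_suml big_nat [RHS]big_nat.
apply: eq_bigr => j /andP[_ jn].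
rewrite /mean_mx -ltnS jn.
transitivity (s (n - j)%N * t j / r n * \sum_(0 <= k < n.+1) band_mx u v j k * x k).
  by rewrite mulr_sumr; apply: eq_bigr => k _; rewrite mulrA.
suff -> : \sum_(0 <= k < n.+1) band_mx u v j k * x k = conv x band_seq j by ring.
rewrite (@big_cat_nat _ _ _ j.+1 0 n.+1)//= [X in _ + X]big_nat [X in _ + X]big1 ?addr0.
  rewrite /conv big_nat [RHS]big_nat; apply: eq_bigr => k /andP[_ kj].
  by rewrite bandE// mulrC.
by move=> k /andP[jk _]; rewrite band0 ?mul0r.
Qed.

Variable e : nat -> K.
Hypothesis he : conv s e = conv_unit K.

(** The inverses of the factors of T, in the reverse order; e is the convolution
    inverse of s. *)
Definition mean_band_inv y : nat -> K :=
  conv (fun i => conv (fun k => r k * y k) e i / t i) band_inv_seq.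
Local Notation W := mean_band_inv.

Lemma mean_bandK : cancel (fun x => T x) W.
Proof.
move=> x; rewrite /W.
have -> : (fun k => r k * T x k) = conv (fun j => t j * conv x band_seq j) s.
  by apply/funext => k; rewrite mean_bandE mulrC mulfVK.
rewrite (convK _ he).
have -> : (fun i => t i * conv x band_seq i / t i) = conv x band_seq.
  by apply/funext => i; rewrite mulrAC mulfV// mul1r.
by rewrite (convK _ (conv_band_inv v hu)).
Qed.

Lemma mean_band_invK : cancel W (fun x => T x).
Proof.
move=> y; apply/funext => n; rewrite mean_bandE /W.
rewrite (convK _ (_ : conv band_inv_seq band_seq = conv_unit K)); last first.
  by rewrite convC (conv_band_inv v hu).
have -> : (fun j => t j * (conv (fun k => r k * y k) e j / t j)) =
    conv (fun k => r k * y k) e.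
  by apply/funext => j; rewrite mulrC mulfVK.
rewrite (convK _ (_ : conv e s = conv_unit K)); last by rewrite convC.
by rewrite mulrAC mulfV// mul1r.
Qed.

Variable A : nat -> nat -> K.
Hypothesis hAt : tilde_cvg s t u v A.

Lemma tilde_weightE k i : (k <= i)%N -> tilde_weight s t k i = e (i - k)%N / t i.
Proof.
move=> ki; rewrite /tilde_weight (conv_inverse_det _ hs he) mulrA; congr (_ * _ / _).
rewrite /Ds; case: (i - k)%N => // ; rewrite det_mx00 mulr1 expr1//.
Qed.

Local Notation tilde := (tilde_mx r s t u v A).

(** Entry k of the N-th truncation of row n of A, multiplied by the inverse of T;
    the double sum runs over the triangle k <= i <= j < N. *)
Definition tilde_partial (n N k : nat) : K :=
  r k * \sum_(k <= i < N) tilde_weight s t k i *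
          \sum_(i <= j < N) tilde_term u v A n i j.

Lemma row_partial_sum y n N :
  \sum_(0 <= j < N) A n j * W y j = \sum_(0 <= k < N) tilde_partial n N k * y k.
Proof.
transitivity (\sum_(0 <= j < N) \sum_(0 <= i < j.+1)
   tilde_term u v A n i j * (conv (fun k => r k * y k) e i / t i)).
  rewrite big_nat [RHS]big_nat; apply: eq_bigr => j _.
  rewrite {1}/W {1}/conv mulr_sumr; apply: eq_bigr => i _.
  by rewrite /tilde_term /band_inv_seq; ring.
rewrite triangle_exchange.
transitivity (\sum_(0 <= i < N) \sum_(0 <= k < i.+1)
   (r k * y k) * (tilde_weight s t k i * \sum_(i <= j < N) tilde_term u v A n i j)).
  rewrite big_nat [RHS]big_nat; apply: eq_bigr => i _.
  rewrite -mulr_suml {1}/conv mulrC !mulr_suml big_nat [RHS]big_nat.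
  apply: eq_bigr => k /andP[_ ki]; rewrite tilde_weightE//; ring.
rewrite triangle_exchange; apply: eq_bigr => k _.
by rewrite -mulr_sumr /tilde_partial; ring.
Qed.

(** The terms with i = k and i = k + 1 are split off as in the definition of
    [tilde_mx]: the entry i = j = k stands alone, and both inner sums start at
    k + 1.  The rest is a diagonal partial sum of a double series. *)
Lemma tilde_partial_cvg n k : (fun N => tilde_partial n N k) @ \oo --> tilde n k.
Proof.
have [c1 c2 c3 c4] := hAt n k.
rewrite /tilde_mx.
pose S2 N := \sum_(k <= i < k.+2) tilde_weight s t k i *
  \sum_(k.+1 <= j < N) tilde_term u v A n i j.
pose S3 N := \sum_(k.+2 <= i < N) tilde_weight s t k i *
  \sum_(i <= j < N) tilde_term u v A n i j.
apply: (@cvg_trans _ ((fun N => r k * (A n k / (s 0%N * t k) * u^-1 + S2 N + S3 N)) @ \oo)).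
  apply: near_eq_cvg; exists k.+2 => // N /= kN.
  congr (_ * _); rewrite (@big_cat_nat _ _ _ k.+2 k N) ?leqW//=; congr (_ + _).
  rewrite /S2 !big_two.
  rewrite (@big_ltn _ _ _ k N) 1?ltnW// mulrDr -!addrA; congr (_ + _).
  rewrite tilde_weightE// subnn /tilde_term subnn expr0 expr1 mul1r.
  have -> : e 0%N = (s 0%N)^-1.
    have := congr1 (fun f => f 0%N) he; rewrite /conv big_nat1 /conv_unit subnn/= => se.
    by apply: (mulfI hs); rewrite se mulfV.
  by rewrite invfM; ring.
apply: cvgM; first exact: cvg_cst.
apply: cvgD; last first.
  pose f M N := \sum_(k.+2 <= i < M) tilde_weight s t k i *
    \sum_(i <= j < N) tilde_term u v A n i j.
  apply: (@pringsheim_diagonal _ _ f) c4 _ c3 => M.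
  rewrite big_nat; apply: (@cvg_trans _ ((fun N => \sum_(k.+2 <= i < M | (k.+2 <= i < M)%N)
      (tilde_weight s t k i * \sum_(i <= j < N) tilde_term u v A n i j)) @ \oo)).
    by apply: near_eq_cvg; exists 0%N => // N _; rewrite /f [RHS]big_nat.
  apply: (cvg_sum_seq _ (u := fun N i => tilde_weight s t k i *
    \sum_(i <= j < N) tilde_term u v A n i j)) => i /andP[ki _].
  by apply: cvgM; [exact: cvg_cst | exact: c2].
apply: cvgD; first exact: cvg_cst.
rewrite /S2 big_two; under eq_fun do rewrite big_two.
apply: cvgD.
  by apply: cvgM; [exact: cvg_cst | apply: c1; rewrite leqnn /= ltnW].
by apply: cvgM; [exact: cvg_cst | apply: c1; rewrite leqW//= ltnS].
Qed.

Hypothesis hA : mx_class (lp_rst p r s t u v) (bv R c) A.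

Lemma inv_carrier y : lp p y -> carrier (lp_rst p r s t u v) (W y).
Proof. by move=> yl; rewrite /= mean_band_invK. Qed.

(** Convergence of the series A_n x for every x in the domain is what feeds the
    uniform boundedness principle. *)
Lemma tilde_row_cvg y n : lp p y ->
  (fun N => \sum_(0 <= k < N) tilde n k * y k) @ \oo --> mxapply A (W y) n.
Proof.
have E y' : (fun N => \sum_(0 <= k < N) tilde_partial n N k * y' k) =
    series (fun k => A n k * W y' k).
  by apply/funext => N; rewrite -row_partial_sum.
move=> yl; have [||M M0 hM] := row_representation hp
  (g := fun N k => tilde_partial n N k) (gl := tilde n).
- by move=> k; exact: tilde_partial_cvg.
- by move=> y' /inv_carrier/hA[/(_ n) + _]; rewrite E.
by have := (hM y yl).1; rewrite E.
Qed.

Lemma mxapply_tilde y : lp p y -> mxapply tilde y = mxapply A (W y).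
Proof.
by move=> yl; apply/funext => n; apply/cvg_lim => //; exact: tilde_row_cvg.
Qed.

Lemma tilde_mx_class : mx_class (lp_space c p) (bv R c) tilde.
Proof.
move=> y yl; split=> [n|]; last by rewrite mxapply_tilde//; have [] := hA (inv_carrier yl).
by apply/cvg_ex; exists (mxapply A (W y) n); exact: tilde_row_cvg.
Qed.

Lemma op_chi_tilde : op_chi (lp_rst p r s t u v) (bv R c) (mxapply A) =
  op_chi (lp_space c p) (bv R c) (mxapply tilde).
Proof.
rewrite /op_chi; congr hausdorff_mnc; apply/seteqP.
split=> [_ [x [xX x1] <-]|_ [y [yl y1] <-]].
  by exists (T x) => //; rewrite mxapply_tilde// mean_bandK.
exists (W y); last by rewrite mxapply_tilde.
by split; [exact: inv_carrier | rewrite /= mean_band_invK].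
Qed.

Lemma compact_op_tilde : compact_op (lp_rst p r s t u v) (bv R c) (mxapply A) <->
  compact_op (lp_space c p) (bv R c) (mxapply tilde).
Proof.
split=> [[_ h]|[_ h]].
  split=> [y yl|z zl [C hC]]; first by have [] := tilde_mx_class yl.
  have [i||phi [phi_homo hy]] := h (fun i => W (z i)); first exact: (inv_carrier (zl i)).
    by exists C => i; rewrite /= mean_band_invK; exact: hC.
  have [y yY hyY] := hy; exists phi; split => //; exists y => //.
  apply: cvg_trans hyY; apply: near_eq_cvg; apply: nearW => i /=.
  by rewrite mxapply_tilde//; exact: zl.
split=> [x xX|z zX [C hC]]; first by have [] := hA xX.
have [i||phi [phi_homo hy]] := h (fun i => T (z i)); first exact: zX.
  by exists C => i; exact: hC.
have [y yY hyY] := hy; exists phi; split => //; exists y => //.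
apply: cvg_trans hyY; apply: near_eq_cvg; apply: nearW => i /=.
by rewrite mxapply_tilde ?mean_bandK//; exact: zX.
Qed.

End Triangle.

Theorem theorem5p5 (R : realType) (c : scalars) (p : R)
    (r s t : nat -> scalar_field R c) (u v : scalar_field R c)
    (A : nat -> nat -> scalar_field R c)
    (hp : 1 < p)
    (hr : forall n, r n != 0) (ht : forall n, t n != 0) (hs : s 0%N != 0)
    (hu : u != 0) (hv : v != 0)
    (hA : mx_class (lp_rst p r s t u v) (bv R c) A)
    (hAt : tilde_cvg s t u v A) :
  let sigma := tail_sup (p / (p - 1)) (tilde_mx r s t u v A) in
  let chiL := op_chi (lp_rst p r s t u v) (bv R c) (mxapply A) in
  [/\ cvgn sigma,
      (limn sigma <= chiL)%E,
      (chiL <= 4%:E * limn sigma)%E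
    & compact_op (lp_rst p r s t u v) (bv R c) (mxapply A) <->
        limn sigma = 0%E].
Proof.
have [e he] := conv_inverse_ex hs.
have cls := tilde_mx_class hp hr ht hs hu he hAt hA.
rewrite /= (op_chi_tilde hp hr ht hs hu he hAt hA); split.
- by apply/cvg_ex; eexists; exact: tail_sup_cvg.
- exact: tail_sup_lim_le_chi.
- exact: chi_le_tail_sup_lim.
- apply: (iff_trans (compact_op_tilde hp hr ht hs hu he hAt hA)); split.
    exact: tail_sup_of_compact.
  exact: compact_of_tail_sup.
Qed.
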